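(* Let $G$ be a countable abelian group, let $k\ge 1$ be an integer, and let $A\subset G$ be an ergodic basis of order $k$. Then $$d^*(AB)\ \ge\ d^*(B)^{1-\frac1k}\qquad\text{and}\qquad d_*(AB)\ \ge\ d_*(B)^{1-\frac1k}$$ for all $B\subset G$ (when $k=1$, the expression $0^0$ is read as $0$). In particular, these inequalities hold for all $B \subset G$ whenever the set $A^k$ is equidistributed in $G$.
   Context: For $A,B\subset G$, $AB=\{ab: a\in A, b\in B\}$, and $A^k$ is the $k$-fold product set of $A$ with itself. A mean on $G$ is a positive norm-one linear functional on $\ell^\infty(G)$; to a mean $\lambda$ one associates the finitely additive probability measure $\lambda'(B)=\lambda(\chi_B)$, $B\subset G$. $\mathcal{L}_G$ is the (non-empty) set of all translation-invariant means on $G$. The upper and lower Banach densities are $d^*(B)=\sup_{\lambda\in\mathcal{L}_G}\lambda'(B)$ and $d_*(B)=\inf_{\lambda\in\mathcal{L}_G}\lambda'(B)$. A $G$-space $(X,\mu)$ is a probability measure space such that $L^2(X,\mu)$ is separable, on which $G$ acts by bi-measurable bijections preserving $\mu$. It is ergodic if there is no $G$-invariant measurable set $B\subset X$ with $0<\mu(B)<1$. For $A\subset G$ and $B\subset X$, $AB=\bigcup_{a\in A}aB$. A set $A\subset G$ is an ergodic set with respect to an ergodic $G$-space $(X,\mu)$ if $\mu(AB)=1$ for every measurable $B\subset X$ with $\mu(B)>0$. $A$ is an ergodic basis of order $k$ if, for every ergodic $G$-space $(X,\mu)$, the set $A^k$ is an ergodic set with respect to $(X,\mu)$. A set $A\subset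 G$ is equidistributed if there is an exhaustion $(A_n)$ of $A$ by finite sets such that $\lim_{n\to\infty}\frac{1}{|A_n|}\sum_{g\in A_n}\chi(g)=0$ for all non-trivial characters $\chi$ of $G$. *)

(* Defs.v *)
From HB Require Import structures.
From mathcomp Require Import all_boot all_order all_algebra finmap.
From mathcomp Require Import complex.
From mathcomp Require Import all_classical all_reals all_analysis.

Set Implicit Arguments.
Unset Strict Implicit.
Unset Printing Implicit Defensive.

Import Order.TTheory GRing.Theory Num.Theory.
Import numFieldNormedType.Exports.

Local Open Scope classical_set_scope.
Local Open Scope ring_scope.

(* The group is written additively: AB is sumset A B, A^k is nsumset A k. *)
Definition sumset (G : zmodType) (A B : set G) : set G :=
  [set a + b | a in A & b in B].

Definition nsumset (G : zmodType) (A : set G) (k : nat) : set G :=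
  iter k (sumset A) [set 0].

Section BoundedFunctions.
Context (T : Type) (R : realType).

Definition bounded_pred : {pred T -> R} := mem [set f : T -> R | bounded_fun f].

Lemma bounded_predP (f : T -> R) :
  reflect (exists M, forall x, `|f x| <= M) (f \in bounded_pred).
Proof.
apply: (iffP idP) => [|[M fM]].
  rewrite inE /= => -[M [_ /(_ (M + 1))]].
  by rewrite ltrDl ltr01 => /(_ isT) fM; exists (M + 1) => x; exact: fM.
rewrite inE /=; exists M; split; first exact: num_real.
by move=> N MN x _ /=; rewrite (le_trans (fM x)) // ltW.
Qed.

Fact bounded_submod_closed : submod_closed bounded_pred.
Proof.
split=> [|a f g /bounded_predP[M fM] /bounded_predP[N gN]]; apply/bounded_predP.
  by exists 0 => x; rewrite normr0.
exists (`|a| * M + N) => x.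
by rewrite (le_trans (ler_normD _ _)) // lerD // normrM ler_wpM2l.
Qed.

HB.instance Definition _ :=
  GRing.isSubmodClosed.Build R (T -> R) bounded_pred bounded_submod_closed.

(* The vector space of bounded real-valued functions on T. *)
Record linfty := Linfty {
  linfty_fun :> T -> R ;
  linfty_bounded : linfty_fun \in bounded_pred }.

HB.instance Definition _ := [isSub for linfty_fun].
HB.instance Definition _ := [Choice of linfty by <:].
HB.instance Definition _ := [SubChoice_isSubLmodule of linfty by <:].

Definition linfty_norm (f : linfty) : R := sup [set `|f x| | x in [set: T]].

Fact indic_bounded (B : set T) : (\1_B : T -> R) \in bounded_pred.
Proof.
apply/bounded_predP; exists 1 => x.
by rewrite indicE ger0_norm // lern1 leq_b1.
Qed.

Definition linfty_indic (B : set T) : linfty := Linfty (indic_bounded B).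

End BoundedFunctions.

Section Means.
Context (G : zmodType) (R : realType).

Fact translate_bounded (a : G) (f : linfty G R) :
  (fun x : G => f (x - a)) \in @bounded_pred G R.
Proof.
have /bounded_predP[M fM] := linfty_bounded f.
by apply/bounded_predP; exists M.
Qed.

Definition translate (a : G) (f : linfty G R) : linfty G R :=
  Linfty (translate_bounded a f).

(* The supremum in mean_norm is the operator norm; as `sup` is 0 on unbounded
   sets, the equation also forces the functional to be bounded. *)
Record is_mean (lambda : {scalar linfty G R}) : Prop := {
  mean_ge0 : forall f : linfty G R, (forall x, 0 <= f x) -> 0 <= lambda f ;
  mean_norm : sup [set `|lambda f| | f in [set f | linfty_norm f <= 1]] = 1 }.

Definition invariant_mean (lambda : {scalar linfty G R}) : Prop :=
  is_mean lambda /\ forall a f, lambda (translate a f) = lambda f.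

Definition upper_density (B : set G) : R :=
  sup [set lambda (linfty_indic R B) | lambda in invariant_mean].

Definition lower_density (B : set G) : R :=
  inf [set lambda (linfty_indic R B) | lambda in invariant_mean].

End Means.

Definition separable_L2 (R : realType) (d : measure_display)
    (X : measurableType d) (mu : probability X R) : Prop :=
  exists D : set (X -> R),
    [/\ countable D, forall g, D g -> g \in Lfun mu 2%:E &
     forall f, f \in Lfun mu 2%:E -> forall e : R, 0 < e ->
       exists2 g, D g & ('N[mu]_2%:E[EFin \o (f \- g)%R] < e%:E)%E].

(* Each act g is a bijection with inverse act (- g), so measurability of all
   the act g is bi-measurability. *)
Record is_Gspace (G : zmodType) (R : realType) (d : measure_display)
    (X : measurableType d) (mu : probability X R) (act : G -> X -> X) : Prop := {
  Gspace_separable : separable_L2 mu ;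
  Gspace_act0 : forall x, act 0 x = x ;
  Gspace_actD : forall g h x, act (g + h) x = act g (act h x) ;
  Gspace_measurable : forall g, measurable_fun [set: X] (act g) ;
  Gspace_preserving : forall g (B : set X), measurable B ->
    mu (act g @` B) = mu B }.

Definition ergodic (G : zmodType) (R : realType) (d : measure_display)
    (X : measurableType d) (mu : probability X R) (act : G -> X -> X) : Prop :=
  ~ exists B : set X,
      [/\ measurable B, forall g, act g @` B = B & (0 < mu B < 1)%E].

Definition ergodic_set (G : zmodType) (R : realType) (d : measure_display)
    (X : measurableType d) (mu : probability X R) (act : G -> X -> X)
    (A : set G) : Prop :=
  forall B : set X, measurable B -> (0 < mu B)%E ->
    mu (\bigcup_(a in A) (act a @` B)) = 1%E.

Definition ergodic_basis (R : realType) (G : zmodType) (k : nat) (A : set G) :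
    Prop :=
  forall (d : measure_display) (X : measurableType d) (mu : probability X R)
    (act : G -> X -> X),
    is_Gspace mu act -> ergodic mu act -> ergodic_set mu act (nsumset A k).

Record is_character (R : realType) (G : zmodType) (chi : G -> R[i]) : Prop := {
  character_norm : forall g, `|chi g| = 1 ;
  characterD : forall g h, chi (g + h) = chi g * chi h }.

(* Nonemptiness makes the averages over the F n meaningful; without it the
   junk value 0^-1 = 0 would make the empty set equidistributed. *)
Record exhaustion (G : zmodType) (A : set G) (F : nat -> {fset G}) : Prop := {
  exhaustion_neq0 : forall n, F n != fset0 ;
  exhaustion_homo : forall m n, (m <= n)%N -> (F m `<=` F n)%fset ;
  exhaustion_cover : \bigcup_n [set` F n] = A }.

Definition equidistributed (R : realType) (G : zmodType) (A : set G) : Prop :=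
  exists2 F : nat -> {fset G}, exhaustion A F &
    forall chi : G -> R[i], is_character chi -> (exists g, chi g != 1) ->
      (fun n => (#|` F n|%:R)^-1 * \sum_(g <- F n) chi g : R[i]^o) @ \oo -->
        (0 : R[i]^o).

(* Real power with 0 to the power 0 read as 0, whereas `powR 0 0 = 1`. *)
Definition powRz (R : realType) (x s : R) : R := if x == 0 then 0 else x `^ s.

(* Main.v *)
Require Import Defs.
From HB Require Import structures.
From mathcomp Require Import all_boot all_order all_algebra finmap.
From mathcomp Require Import complex.
From mathcomp Require Import all_classical all_reals all_analysis.
From mathcomp Require Import measurable_realfun.
From mathcomp Require Import ring lra.

(** The proof passes from densities to an ergodic measure preserving system, where
    a Pluennecke inequality holds, and back.

    _From means to measures._  Let [l] be an invariant mean.  The itinerary of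
    [x] records which translates of [B] contain [x]; it maps [G] equivariantly to
    the shift on [{0,1}^G], and carries [l] to a finitely additive measure on
    cylinders, which by compactness extends to a shift invariant probability
    measure [mu].  The cylinder [B'] of configurations with a 1 at the origin
    satisfies [mu B' = l B] and [mu (A B') <= l (A + B)].  If [l] is an extreme
    point of the set of invariant means, then [mu] is ergodic, since [l] can be
    conditioned on an invariant set of configurations.  Extremality is only needed
    on countably many sets, and a mean that is lexicographically maximal for a
    sequence of functionals has it ([lex_maximiser],
    [ergodic_maximising_mean]).  The first functional of the sequence is free: it
    is chosen so that [l] realises the upper density of [B], respectively the lower
    density of [A + B].

    _The Pluennecke inequality._  If [A^k] moves every non-null set onto almost
    everything, then [mu B' ^ (k - 1) <= mu (A B') ^ k] for non-null [B']
    ([measure_pluennecke]).  For [K > mu (A B') / mu B'] take [E] in [B'] that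
    maximises [K mu E - mu (A E)]; Petridis's argument ([petridis]) gives
    [mu (C A E) <= K mu (C E)] for all [C], so [1 = mu (A^k E) <= K^k mu E].  The
    maximiser exists because the quantity is supermodular in [E]
    ([supermodular_max]).

    _Equidistributed sets._  Let [S] be equidistributed, along finite sets [F n].
    The claim that [S] moves non-null sets [B] of an ergodic system onto almost
    everything reduces to the fact that the averages over [F n] of the translates
    of the indicator of [B] become invariant in mean square.  The defect of
    invariance is an affine functional, the energy, of the positive definite
    function [g |-> mu (g B n B) / mu B].  The extreme normalised positive definite
    functions are real parts of characters ([extreme_dAlembert],
    [dAlembert_character]), and there the energies tend to 0 by
    equidistribution.  In place of Bochner's theorem and dominated convergence,
    Simons's inequality ([simons_absurd]) carries this over to all positive
    definite functions. *)

Set Implicit Arguments.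
Unset Strict Implicit.
Unset Printing Implicit Defensive.

Import Order.TTheory GRing.Theory Num.Theory.
Import numFieldNormedType.Exports.

Local Open Scope classical_set_scope.
Local Open Scope ring_scope.

(** * Limits along a free ultrafilter *)

Lemma exists_free_ultrafilter :
  exists U : set_system nat, UltraFilter U /\ \oo `<=` U.
Proof. exact: ultraFilterLemma. Qed.

(** With one free ultrafilter fixed, every bounded real sequence has a limit that
   is linear and monotone in the sequence.  Taken pointwise, these limits replace
   compactness arguments for spaces of functionals, for configurations and for
   positive definite functions. *)
Definition natU : set_system nat := sval (cid exists_free_ultrafilter).

Instance natU_ultra : UltraFilter natU.
Proof. by have [] := svalP (cid exists_free_ultrafilter). Qed.

Instance natU_proper : ProperFilter natU.
Proof. exact: ultra_proper. Qed.

Lemma natU_eventually (P : set nat) : (\forall n \near \oo, P n) -> natU P.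
Proof. by have [_ /(_ P)] := svalP (cid exists_free_ultrafilter). Qed.

Section Ulim.
Context {R : realType}.
Implicit Types u v : nat -> R.

Definition ulim u : R := lim (fmap u natU).

Lemma cvg_ulim u M : natU [set n | `|u n| <= M] -> u @ natU --> ulim u.
Proof.
move=> uM; apply/cvg_ex.
have := @segment_compact R (- M) M.
rewrite compact_ultra => /(_ (u @ natU)) [||l [_ ul]].
- split; first exact: fmap_proper_filter.
  move=> H HP HU; rewrite eqEsubset; split => // A HA.
  have [//|UA] := in_ultra_setVsetC (u @^-1` A) natU_ultra.
  have : H (~` A) by apply: HU.
  by move=> /(filterI HA); rewrite setICr => /filter_ex[].
- rewrite /=; apply: filterS uM => n /=.
  by rewrite ler_norml in_itv /=.
by exists l.
Qed.

Lemma ulim_cvg u l : u @ natU --> (l : R) -> ulim u = l.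
Proof. by move=> ul; apply/cvg_lim. Qed.

Lemma cvg_eventually_natU u l : u @ \oo --> (l : R) -> u @ natU --> (l : R).
Proof. by move=> ul A /ul uA; apply: natU_eventually. Qed.

Lemma ulim_lim u l : u @ \oo --> (l : R) -> ulim u = l.
Proof. by move=> /cvg_eventually_natU /ulim_cvg. Qed.

Lemma ulim_cst c : ulim (fun=> c) = c.
Proof. by apply: ulim_cvg; exact: cvg_cst. Qed.

Lemma ulim_comb a b u v M N :
  (forall n, `|u n| <= M) -> (forall n, `|v n| <= N) ->
  ulim (fun n => a * u n + b * v n) = a * ulim u + b * ulim v.
Proof.
move=> uM vN; apply: ulim_cvg; apply: cvgD; apply: cvgMr.
  by apply: (@cvg_ulim _ M); apply: nearW.
by apply: (@cvg_ulim _ N); apply: nearW.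
Qed.

End Ulim.

(** * Lexicographic maximisers of continuous functionals *)

Section LexicographicMaximisers.
Context {R : realType} {I : Type}.
Implicit Types (K : set (I -> R)) (phi psi : I -> R) (h : (I -> R) -> R).

Definition plim (Phi : nat -> I -> R) : I -> R :=
  fun i => ulim (fun n => Phi n i).

(** For a pointwise bounded K this is what is needed of compactness for pointwise
   convergence: sequences in K, up to a natU-null set of indices, have a limit
   point in K. *)
Definition uclosed K :=
  forall Phi : nat -> I -> R, natU [set n | K (Phi n)] -> K (plim Phi).

Definition ucontinuous K h :=
  (exists M, forall phi, K phi -> `|h phi| <= M) /\
  forall Phi : nat -> I -> R, natU [set n | K (Phi n)] ->
    (fun n => h (Phi n)) @ natU --> h (plim Phi).

Lemma ucontinuous_coord K i (M : R) :
  (forall phi, K phi -> `|phi i| <= M) -> ucontinuous K (fun phi => phi i).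
Proof.
move=> KM; split; first by exists M.
move=> Phi KPhi; apply: (@cvg_ulim _ _ M).
by apply: filterS KPhi => n /KM.
Qed.

Lemma ucontinuous_comb K a b g h : ucontinuous K g -> ucontinuous K h ->
  ucontinuous K (fun phi => a * g phi + b * h phi).
Proof.
move=> [[M gM] gc] [[N hN] hc]; split.
  exists (`|a| * M + `|b| * N) => phi Kphi.
  rewrite (le_trans (ler_normD _ _)) // !normrM lerD // ler_wpM2l //.
    exact: gM.
  exact: hN.
by move=> Phi KPhi; apply: cvgD; apply: cvgMr; [exact: gc|exact: hc].
Qed.

(** The faces obtained by maximising h 0, then h 1 on the first face, and so on.
   A point in all of them behaves like an extreme point with respect to the
   countably many functionals h j. *)
Fixpoint lexface K (h : nat -> (I -> R) -> R) (j : nat) : set (I -> R) :=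
  if j is j'.+1 then
    [set phi | lexface K h j' phi /\
       forall psi, lexface K h j' psi -> h j' psi <= h j' phi]
  else K.

Lemma lexface_sub K (h : nat -> (I -> R) -> R) i j : (i <= j)%N -> lexface K h j `<=` lexface K h i.
Proof.
elim: j => [|j IH]; first by rewrite leqn0 => /eqP ->.
rewrite leq_eqVlt => /predU1P[->//|ij] phi [phij _].
exact: IH.
Qed.

Lemma lexface_closed K (h : nat -> (I -> R) -> R) j : uclosed K -> (forall j, ucontinuous K (h j)) ->
  uclosed (lexface K h j).
Proof.
move=> Kc hc; elim: j => [//|j IH] Phi PhiF; split.
  by apply: IH; apply: filterS PhiF => n [].
move=> psi psiF.
have PhiK : natU [set n | K (Phi n)].
  apply: filterS PhiF => n [+ _].
  exact: (@lexface_sub _ _ 0).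
have /cvgr_to_ge := (hc j).2 _ PhiK; apply.
by apply: filterS PhiF => n [_]; exact.
Qed.

(** The supremum of a continuous functional on a nonempty closed face is
   reached at the ultrafilter limit of a maximising sequence. *)
Lemma lexface_nonempty K (h : nat -> (I -> R) -> R) j : K !=set0 -> uclosed K ->
  (forall j, ucontinuous K (h j)) -> lexface K h j !=set0.
Proof.
move=> K0 Kc hc; elim: j => [//|j [psi0 psi0F]].
have FK : lexface K h j `<=` K by exact: (@lexface_sub _ _ 0).
set V := [set h j phi | phi in lexface K h j].
have [[M hM] hj] := hc j.
have hsV : has_sup V.
  split; first by exists (h j psi0), psi0.
  exists M => _ [phi /FK/hM hphi <-].
  by rewrite (le_trans _ hphi) // ler_norm.
have /choice[Phi PhiP] : forall n : nat, exists phi,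
    lexface K h j phi /\ sup V - n.+1%:R^-1 < h j phi.
  move=> n; have n0 : 0 < n.+1%:R^-1 :> R by rewrite invr_gt0.
  by have [_ [phi Fphi <-] ?] := sup_adherent n0 hsV; exists phi.
have PhiF : natU [set n | lexface K h j (Phi n)].
  by apply: filterS filterT => n _; have [] := PhiP n.
have PhiK : natU [set n | K (Phi n)] by apply: filterS PhiF => n /FK.
exists (plim Phi); split; first exact: lexface_closed.
move=> psi psiF; have le1 : h j psi <= sup V.
  by apply: ub_le_sup; [exact: hsV.2|exists psi].
apply: le_trans le1 _.
have c1 : (fun n : nat => sup V - n.+1%:R^-1) @ natU --> sup V.
  apply: cvg_eventually_natU; rewrite -[X in _ --> X]subr0.
  apply: cvgB; first exact: cvg_cst.
  exact: cvg_harmonic.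
apply: (ler_cvg_to c1 (hj _ PhiK)).
by apply: filterS filterT => n _; rewrite ltW //; have [] := PhiP n.
Qed.

(** If phi = t psi1 + (1 - t) psi2 with both psi's in K, then h 0 psi1 and
   h 0 psi2 are at most h 0 phi and average to it, so they are equal to it; thus
   both psi's lie in the next face, where the same argument applies to h 1. *)
Theorem lex_maximiser K (h : nat -> (I -> R) -> R) : K !=set0 -> uclosed K ->
  (forall j, ucontinuous K (h j)) ->
  exists phi, [/\ K phi, forall psi, K psi -> h 0%N psi <= h 0%N phi &
    forall t psi1 psi2, 0 < t < 1 -> K psi1 -> K psi2 ->
      (forall j, h j phi = t * h j psi1 + (1 - t) * h j psi2) ->
      forall j, h j psi1 = h j phi].
Proof.
move=> K0 Kc hc.
have /choice[Phi PhiF] := fun j => @lexface_nonempty K h j K0 Kc hc.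
have phiF j : lexface K h j (plim Phi).
  apply: (lexface_closed Kc hc); apply: natU_eventually.
  exists j => // n /= jn; exact: lexface_sub (PhiF n).
(* A limit of points of the successive faces lies in every face, since the
   faces decrease and are closed. *)
exists (plim Phi); split; [exact: (phiF 0%N)|exact: (phiF 1%N).2|].
move=> t psi1 psi2 /andP[t0 t1] K1 K2 hcomb.
have F j : [/\ lexface K h j psi1, lexface K h j psi2 &
    (h j psi1 = h j (plim Phi) /\ h j psi2 = h j (plim Phi))].
  have heq i : lexface K h i psi1 -> lexface K h i psi2 ->
      h i psi1 = h i (plim Phi) /\ h i psi2 = h i (plim Phi).
    move=> F1 F2; have [_ phimax] := phiF i.+1.
    have := phimax _ F1; have := phimax _ F2; have := hcomb i.
    move: (h i psi1) (h i psi2) (h i _) => x y z zE yz xz.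
    suff : x = z /\ y = z by [].
    by split; nra.
  elim: j => [|j [F1 F2 [e1 e2]]]; first by split => //; exact: heq.
  have G1 : lexface K h j.+1 psi1.
    by split => // psi Fpsi; rewrite e1; exact: (phiF j.+1).2.
  have G2 : lexface K h j.+1 psi2.
    by split => // psi Fpsi; rewrite e2; exact: (phiF j.+1).2.
  by split => //; exact: heq.
by move=> j; have [_ _ []] := F j.
Qed.

End LexicographicMaximisers.

(** * Real-valued probabilities *)

Section RealProbability.
Context {R : realType} {d : measure_display} {X : measurableType d}.
Context (mu : probability X R).
Implicit Types E F : set X.

Definition rmu E : R := fine (mu E).

Lemma rmuE E : measurable E -> mu E = (rmu E)%:E.
Proof. by move=> mE; rewrite /rmu fineK // fin_num_measure. Qed.

Lemma rmu_ge0 E : 0 <= rmu E.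
Proof. exact: fine_ge0. Qed.

Lemma le_rmu E F : measurable E -> measurable F -> E `<=` F -> rmu E <= rmu F.
Proof.
move=> mE mF EF; rewrite -lee_fin -!rmuE //.
by apply: le_measure => //; rewrite inE.
Qed.

Lemma rmu_setT : rmu [set: X] = 1.
Proof. by rewrite /rmu probability_setT. Qed.

Lemma rmu_le1 E : measurable E -> rmu E <= 1.
Proof. by move=> mE; rewrite -rmu_setT; apply: le_rmu. Qed.

Lemma rmu0 : rmu set0 = 0.
Proof. by rewrite /rmu measure0. Qed.

Lemma rmuDI E F : measurable E -> measurable F ->
  rmu E = rmu (E `\` F) + rmu (E `&` F).
Proof.
move=> mE mF; apply: EFin_inj; rewrite EFinD -!rmuE //.
- exact: (measureDI mu).
- exact: measurableI.
- exact: measurableD.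
Qed.

Lemma rmuD_sub E F : measurable E -> measurable F -> F `<=` E ->
  rmu (E `\` F) = rmu E - rmu F.
Proof.
by move=> mE mF /setIidPr EF; rewrite (rmuDI mE mF) EF addrK.
Qed.

Lemma rmuUD E F : measurable E -> measurable F ->
  rmu (E `|` F) = rmu E + rmu (F `\` E).
Proof.
move=> mE mF; rewrite (rmuDI (measurableU _ _ mE mF) mE) addrC.
by rewrite setUK setDUl setDv set0U.
Qed.

Lemma rmuUI E F : measurable E -> measurable F ->
  rmu (E `|` F) + rmu (E `&` F) = rmu E + rmu F.
Proof.
by move=> mE mF; rewrite rmuUD // (rmuDI mF mE) (setIC F) addrA.
Qed.

Lemma le_rmuU E F : measurable E -> measurable F ->
  rmu (E `|` F) <= rmu E + rmu F.
Proof. by move=> mE mF; rewrite -rmuUI // lerDl rmu_ge0. Qed.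

Lemma cvg_rmu_bigcup (F : nat -> set X) : (forall n, measurable (F n)) ->
  nondecreasing_seq F -> rmu \o F @ \oo --> rmu (\bigcup_n F n).
Proof.
move=> mF ndF; apply: fine_cvg; rewrite -rmuE; last exact: bigcup_measurable.
apply: nondecreasing_cvg_mu => //; exact: bigcup_measurable.
Qed.

Lemma cvg_rmu_bigcap (F : nat -> set X) : (forall n, measurable (F n)) ->
  nonincreasing_seq F -> rmu \o F @ \oo --> rmu (\bigcap_n F n).
Proof.
move=> mF ndF; apply: fine_cvg; rewrite -rmuE; last exact: bigcap_measurable.
apply: nonincreasing_cvg_mu => //; last exact: bigcap_measurable.
by rewrite ltey_eq fin_num_measure.
Qed.

End RealProbability.

(** * Supermodular set functions attain their supremum *)

Section SupermodularMaximum.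
Context {R : realType} {T : Type} (M : set (set T)) (f : set T -> R) (c : R).
Hypothesis MU : setU_closed M.
Hypothesis MI : setI_closed M.
Hypothesis Mcup : forall F : nat -> set T,
  (forall n, M (F n)) -> M (\bigcup_n F n).
Hypothesis Mcap : forall F : nat -> set T,
  (forall n, M (F n)) -> M (\bigcap_n F n).
Hypothesis fbnd : forall E, M E -> f E <= c.
Hypothesis fsup : forall E F, M E -> M F ->
  f E + f F <= f (E `|` F) + f (E `&` F).
Hypothesis fup : forall (F : nat -> set T) x, (forall n, M (F n)) ->
  nondecreasing_seq F -> (forall n, x <= f (F n)) -> x <= f (\bigcup_n F n).
Hypothesis fdown : forall (F : nat -> set T) x, (forall n, M (F n)) ->
  nonincreasing_seq F -> (forall n, x <= f (F n)) -> x <= f (\bigcap_n F n).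

(** Let the Z n be nearly optimal, with summable defects 2^-n.  Since
   f (E u F) >= f E + f F - f (E n F) and the last term is at most the supremum,
   defects add up under unions.  Hence the union of the Z i for i >= m has defect
   at most 2 * 2^-m, and the decreasing intersection over m of these unions has
   defect zero. *)
Theorem supermodular_max : M !=set0 ->
  exists2 E, M E & forall F, M F -> f F <= f E.
Proof.
move=> [E0 ME0].
set V := [set f E | E in M].
have hsV : has_sup V.
  by split; [exists (f E0), E0|exists c => _ [E /fbnd ? <-]].
have le_sup E : M E -> f E <= sup V.
  by move=> ME; apply: ub_le_sup; [exact: hsV.2|exists E].
pose r (n : nat) : R := 2^-1 ^+ n.
have r0 n : 0 < r n by rewrite exprn_gt0.
have rS n : r n = r n.+1 + r n.+1 by rewrite /r exprS; lra.
have /choice[Z ZP] n : exists E, M E /\ sup V - r n < f E.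
  by have [_ [E ME <-] ?] := sup_adherent (r0 n) hsV; exists E.
pose U := fix U m n := if n is n'.+1 then U m n' `|` Z (m + n)%N else Z m.
have US m n : U m n.+1 = U m n `|` Z (m + n.+1)%N by [].
have MUmn m n : M (U m n).
  elim: n => [|n IH]; first exact: (ZP m).1.
  by rewrite US; apply: MU => //; exact: (ZP _).1.
have fU m n : sup V - 2 * r m + r (m + n)%N <= f (U m n).
  elim: n => [|n IH]; first by have := (ZP m).2; rewrite addn0 /=; lra.
  have MZ := (ZP (m + n.+1)%N).1.
  have := fsup (MUmn m n) MZ; rewrite -US.
  have := le_sup _ (MI (MUmn m n) MZ).
  have := (ZP (m + n.+1)%N).2.
  by rewrite addnS; have := rS (m + n)%N; lra.
pose W m := \bigcup_n U m n.
have MW m : M (W m) by exact: Mcup.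
have fW m : sup V - 2 * r m <= f (W m).
  apply: fup => [//|i j ij|n].
    rewrite subsetEset -(subnK ij) addnC; elim: (j - i)%N => [|k]; first by rewrite addn0.
    by move=> IH; rewrite addnS US; apply: subset_trans IH _; exact: subsetUl.
  by have := fU m n; have := r0 (m + n)%N; rewrite -/(r (m + n)%N); lra.
have WS m : W m.+1 `<=` W m.
  move=> x [n _]; elim: n => [|n IH] /=.
    by move=> Zx; exists 1%N => //=; right; rewrite addn1.
  by case=> // Zx; exists n.+2 => //; right; rewrite addnS -addSn.
have Wle i j : (i <= j)%N -> W j `<=` W i.
  move=> ij; rewrite -(subnK ij) addnC; elim: (j - i)%N => [|k]; first by rewrite addn0.
  by move=> IH; rewrite addnS; exact: subset_trans (WS _) IH.
have capW m : \bigcap_n W n = \bigcap_n W (m + n)%N.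
  apply/seteqP; split => x Wx n _; first exact: Wx.
  by apply: (Wle n (m + n)%N); [exact: leq_addl|exact: Wx].
exists (\bigcap_n W n) => [|F MF]; first exact: Mcap.
apply: le_trans (le_sup _ MF) _.
have step m : sup V - 2 * r m <= f (\bigcap_n W n).
  rewrite (capW m); apply: fdown => [//|i j ij|n].
    by rewrite subsetEset; apply: Wle; rewrite leq_add2l.
  apply: le_trans (fW _).
  have : r (m + n)%N <= r m.
    by rewrite /r exprD ler_piMr ?exprn_ge0 // exprn_ile1 // invf_le1 // ler1n.
  lra.
have c1 : (fun m => sup V - 2 * r m) @ \oo --> sup V.
  rewrite -[X in _ --> X]subr0 -[X in _ - X](mulr0 2).
  apply: cvgB; first exact: cvg_cst.
  apply: cvgMr; apply: cvg_expr.
  by rewrite ger0_norm // invf_lt1 // ltr1n.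
by apply: (cvgr_to_le c1); exact: nearW.
Qed.

End SupermodularMaximum.

(** * Group actions on measurable sets *)

Lemma countable_enumeration (G : zmodType) : countable [set: G] ->
  exists e : nat -> G, forall g, exists n, e n = g.
Proof.
move=> /countable_injP[f finj].
exists (fun n => xget 0 [set g | f g = n]) => g; exists (f g).
case: xgetP => [h _ /= fh|/(_ g)[]//].
exact: (finj h g (mem_setT _) (mem_setT _) fh).
Qed.

Section ActionOnSets.
Context {R : realType} {G : zmodType} (hG : countable [set: G]).
Context {d : measure_display} {X : measurableType d} (mu : probability X R).
Context (act : G -> X -> X) (Gact : is_Gspace mu act).
Implicit Types (A C : set G) (B E F Z : set X) (a g : G).

Definition actset A B : set X := \bigcup_(a in A) (act a @` B).

Lemma actK a : cancel (act a) (act (- a)).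
Proof. by move=> x; rewrite -(Gspace_actD Gact) addNr (Gspace_act0 Gact). Qed.

Lemma actNK a : cancel (act (- a)) (act a).
Proof. by move=> x; rewrite -(Gspace_actD Gact) addrN (Gspace_act0 Gact). Qed.

Lemma image_actE a B : act a @` B = act (- a) @^-1` B.
Proof.
apply/seteqP; split => [_ [x Bx <-]|x Bx] /=; first by rewrite actK.
by exists (act (- a) x) => //; rewrite actNK.
Qed.

Lemma measurable_act a B : measurable B -> measurable (act a @` B).
Proof.
move=> mB; rewrite image_actE -[X in measurable X]setTI.
exact: (Gspace_measurable Gact).
Qed.

Lemma rmu_act a B : measurable B -> rmu mu (act a @` B) = rmu mu B.
Proof. by move=> mB; rewrite /rmu (Gspace_preserving Gact). Qed.

Lemma measurable_actset A B : measurable B -> measurable (actset A B).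
Proof.
move=> mB; rewrite /actset bigcup_mkcond.
apply: countable_bigcupT_measurable => // a.
by case: ifP => // _; exact: measurable_act.
Qed.

Lemma actset_sumset A C B : actset A (actset C B) = actset (sumset A C) B.
Proof.
apply/seteqP; split => [_ [a Aa [_ [c Cc [x Bx <-]] <-]]|].
  exists (a + c); first by exists a => //; exists c.
  by exists x => //; rewrite (Gspace_actD Gact).
move=> _ [_ [a Aa [c Cc <-]] [x Bx <-]].
exists a => //; exists (act c x); first by exists c => //; exists x.
by rewrite (Gspace_actD Gact).
Qed.

Lemma sumsetC A C : sumset A C = sumset C A.
Proof.
by apply/seteqP; split => _ [a Aa [c Cc <-]]; exists c => //; exists a => //;
  rewrite addrC.
Qed.

Lemma actsetU A B E : actset A (B `|` E) = actset A B `|` actset A E.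
Proof.
apply/seteqP; split => x.
  by move=> [a Aa [y [By|Ey] <-]]; [left|right]; exists a => //; exists y.
by move=> [|] [a Aa [y By <-]]; exists a => //; exists y => //; [left|right].
Qed.

Lemma sub_actset A B E : B `<=` E -> actset A B `<=` actset A E.
Proof. by move=> BE _ [a Aa [y /BE Ey <-]]; exists a => //; exists y. Qed.

Lemma sub_actsetl A C B : A `<=` C -> actset A B `<=` actset C B.
Proof. by move=> AC _ [a /AC Ca [y Ey <-]]; exists a => //; exists y. Qed.

Lemma actset_bigcup A (F : nat -> set X) :
  actset A (\bigcup_n F n) = \bigcup_n actset A (F n).
Proof.
apply/seteqP; split => [_ [a Aa [y [n _ Fy] <-]]|_ [n _ [a Aa [y Fy <-]]]].
  by exists n => //; exists a => //; exists y.
by exists a => //; exists y => //; exists n.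
Qed.

Lemma actset1 a B : actset [set a] B = act a @` B.
Proof. by rewrite /actset bigcup_set1. Qed.

Lemma actset_cons c s B :
  actset [set` c :: s] B = act c @` B `|` actset [set` s] B.
Proof.
apply/seteqP; split => x.
  move=> [a /=]; rewrite inE => /predU1P[->|sa] Bx; first by left.
  by right; exists a.
move=> [Bx|[a /= sa Bx]]; first by exists c => //=; rewrite mem_head.
by exists a => //=; rewrite inE sa orbT.
Qed.

(** A countable set A of group elements acts, up to small measure, like a finite
   subset; all the estimates below are proved for finite sets and extended by
   this lemma. *)
Lemma actset_exhaustion A : exists s : nat -> seq G,
  (forall n a, a \in s n -> A a) /\
  forall Z, measurable Z ->
    (fun n => rmu mu (actset [set` s n] Z)) @ \oo --> rmu mu (actset A Z).
Proof.
have [e esurj] := countable_enumeration hG.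
pose s n := [seq e i | i <- iota 0 n & `[< A (e i) >] ].
have sP n a : (a \in s n) <-> (A a /\ exists2 i, (i < n)%N & e i = a).
  split=> [/mapP[j]|[Aa [i ni ia]]].
    by rewrite mem_filter mem_iota add0n => /and3P[/asboolP Ai _ ?] ->; split => //; exists j.
  rewrite /s -ia map_f // mem_filter mem_iota add0n leq0n ni !andbT.
  by apply/asboolP; rewrite ia.
exists s; split => [n a /sP[]//|Z mZ].
have -> : actset A Z = \bigcup_n actset [set` s n] Z.
  apply/seteqP; split => [_ [a Aa [y Zy <-]]|].
    have [n en] := esurj a; exists n.+1 => //; exists a; last by exists y.
    by apply/sP; split => //; exists n.
  by move=> _ [n _ [a /sP[Aa _] [y Zy <-]]]; exists a => //; exists y.
apply: cvg_rmu_bigcup => [n|i j ij]; first exact: measurable_actset.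
rewrite subsetEset; apply: sub_actsetl => a /sP[Aa [k ki ka]].
by apply/sP; split => //; exists k => //; exact: leq_trans ij.
Qed.

Lemma actset_finite_le A B E (K : R) : measurable B -> measurable E ->
  (forall s : seq G, rmu mu (actset [set` s] E) <= K * rmu mu (actset [set` s] B)) ->
  rmu mu (actset A E) <= K * rmu mu (actset A B).
Proof.
move=> mB mE fin; have [s [_ cs]] := actset_exhaustion A.
have c : (fun n => K * rmu mu (actset [set` s n] B)) @ \oo -->
    K * rmu mu (actset A B) by apply: cvgMr; exact: cs.
by apply: (ler_cvg_to (cs _ mE) c); apply: nearW => n; exact: fin.
Qed.

End ActionOnSets.

(** * The Pluennecke inequality for measure preserving actions *)

Section Pluennecke.
Context {R : realType} {G : zmodType} (hG : countable [set: G]).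
Context {d : measure_display} {X : measurableType d} (mu : probability X R).
Context (act : G -> X -> X) (Gact : is_Gspace mu act).
Local Notation actset := (actset act).
Local Notation m := (rmu mu).

(** Petridis's argument.  The hypothesis says that E maximises K mu(Z) - mu(AZ)
   among its measurable subsets Z, i.e. mu(AE) - mu(AZ) <= K (mu(E) - mu(Z)).
   Add the elements c of C one at a time: what c adds to CE is c(E - Z), where Z
   is the part of E that c maps into the previous C'E, while what c adds to CAE
   is contained in cAE - cAZ, because cAZ = A(cZ) lies in C'AE. *)
Lemma petridis (A : set G) (K : R) (E : set X) : measurable E -> 0 <= K ->
  (forall Z, measurable Z -> Z `<=` E ->
     K * m Z - m (actset A Z) <= K * m E - m (actset A E)) ->
  forall C : set G, m (actset C (actset A E)) <= K * m (actset C E).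
Proof.
move=> mE K0 Emax C; apply: (actset_finite_le hG Gact) => //.
  exact: (measurable_actset hG Gact).
elim=> [|c s IH]; first by rewrite /actset set_nil !bigcup_set0 rmu0 mulr0.
rewrite !(actset_cons act).
set P := actset [set` s] (actset A E) in IH *.
set Q := actset [set` s] E in IH *.
have mA B : measurable B -> measurable (actset A B) by exact: (measurable_actset hG Gact).
have mP : measurable P by apply: (measurable_actset hG Gact) => //; exact: mA.
have mQ : measurable Q by exact: (measurable_actset hG Gact).
have mact a B : measurable B -> measurable (act a @` B) by exact: (measurable_act Gact).
pose Z := E `&` act (- c) @` Q.
have mZ : measurable Z by apply: measurableI => //; exact: mact.
have ZE : Z `<=` E by exact: subIsetl.
have cAZP : act c @` (actset A Z) `<=` P.
  move=> _ [_ [a Aa [z [Ez [y Qy yz]] <-]] <-].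
  case: Qy => g sg [x Ex xy].
  exists g => //; exists (act a x); first by exists a => //; exists x.
  rewrite -yz -xy -!(Gspace_actD Gact); congr act.
  by rewrite [c + a - c]addrAC subrr add0r addrC.
have cZQ : act c @` Z `<=` Q.
  by move=> _ [_ [_ [y Qy <-]] <-]; rewrite (actNK Gact).
have leP : m (act c @` (actset A E) `|` P) <= m P + (m (actset A E) - m (actset A Z)).
  rewrite setUC rmuUD //; last by apply: mact; exact: mA.
  rewrite lerD2l -(rmu_act Gact c (mA _ mE)) -(rmu_act Gact c (mA _ mZ)).
  rewrite -rmuD_sub; [| apply: mact; exact: mA..|]; last first.
    by apply: image_subset; exact: sub_actset.
  apply: le_rmu; [by apply: measurableD => //; apply: mact; exact: mA..|].
  exact: setDS.
have eqQ : m (act c @` E `|` Q) = m Q + (m E - m Z).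
  rewrite setUC rmuUD //; last exact: mact.
  rewrite -(rmu_act Gact c mE) -(rmu_act Gact c mZ) -rmuD_sub; [| exact: mact..|].
    congr (_ + m _); apply/seteqP; split => _ [[x Ex <-] nQ]; split.
    - by exists x.
    - by move=> /cZQ.
    - by exists x.
    - move=> Qx; apply: nQ; exists x => //; split => //.
      by exists (act c x) => //; rewrite (actK Gact).
  exact: image_subset.
have := Emax Z mZ ZE; rewrite eqQ mulrDr; nra.
Qed.

(** The maximiser exists because Z |-> mu(AZ) is submodular: A(E n F) is contained
   in AE n AF and A(E u F) = AE u AF.  Its measure is positive as soon as K
   exceeds mu(AB) / mu(B), for then B itself has a positive score.  Maximising
   the difference instead of minimising the ratio mu(AZ) / mu(Z) is what makes
   an exact optimum available in a measure space. *)
Lemma pluennecke_maximiser (A : set G) (K : R) (B : set X) :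
  measurable B -> 0 <= K -> m (actset A B) < K * m B ->
  exists E, [/\ measurable E, E `<=` B, 0 < m E &
    forall C : set G, m (actset C (actset A E)) <= K * m (actset C E)].
Proof.
move=> mB K0 KB.
pose M := [set Z | measurable Z /\ Z `<=` B].
pose f Z := K * m Z - m (actset A Z).
have mA Z : measurable Z -> measurable (actset A Z) by exact: (measurable_actset hG Gact).
have [|||||||||E [mE EB] Emax] := @supermodular_max R X M f K.
- by move=> E F [mE EB] [mF FB]; split; [exact: measurableU|move=> x [/EB|/FB]].
- by move=> E F [mE EB] [mF FB]; split; [exact: measurableI|move=> x [/EB]].
- by move=> F MF; split; [apply: bigcup_measurable => n _; exact: (MF n).1|
    move=> x [n _ /(MF n).2]].
- by move=> F MF; split; [apply: bigcapT_measurable => n; exact: (MF n).1|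
    move=> x /(_ 0%N Logic.I)/(MF 0%N).2].
- move=> E [mE _]; rewrite /f; have := rmu_le1 mu mE.
  have := rmu_ge0 mu (actset A E); nra.
- move=> E F [mE _] [mF _]; rewrite /f actsetU.
  have := rmuUI mu mE mF; have := rmuUI mu (mA _ mE) (mA _ mF).
  have : m (actset A (E `&` F)) <= m (actset A E `&` actset A F).
    apply: le_rmu; [exact/mA/measurableI|by apply: measurableI; exact: mA|].
    by move=> x [a Aa [y [Ey Fy] <-]]; split; exists a => //; exists y.
  set x1 := m (_ `&` _); set x2 := m (actset A (E `&` F)); nra.
- move=> F x MF ndF xF; rewrite /f actset_bigcup.
  have ndAF : nondecreasing_seq (fun n => actset A (F n)).
    by move=> i j /ndF; rewrite !subsetEset; exact: sub_actset.
  have c1 := cvg_rmu_bigcup (mu := mu) (fun n => (MF n).1) ndF.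
  have c2 := cvg_rmu_bigcup (mu := mu) (fun n => mA _ (MF n).1) ndAF.
  have c3 : (fun n => K * m (F n) - m (actset A (F n))) @ \oo -->
      K * m (\bigcup_n F n) - m (\bigcup_n actset A (F n)).
    by apply: cvgB => //; exact: cvgMr.
  by apply: (cvgr_to_ge c3); exact: nearW.
- move=> F x MF niF xF; rewrite /f.
  have mF n := (MF n).1.
  have c1 := cvg_rmu_bigcap (mu := mu) mF niF.
  have c3 : (fun n => K * m (F n) - m (actset A (\bigcap_n F n))) @ \oo -->
      K * m (\bigcap_n F n) - m (actset A (\bigcap_n F n)).
    by apply: cvgB; [exact: cvgMr|exact: cvg_cst].
  apply: (cvgr_to_ge c3); apply: nearW => n.
  apply: le_trans (xF n) _; rewrite lerD2l lerN2.
  apply: le_rmu; [apply/mA/bigcapT_measurable => k|exact: mA|apply: sub_actset].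
    exact: mF.
  by move=> y /(_ n); exact.
- by exists B; split.
exists E; split => //.
  have := Emax B (conj mB (@subset_refl _ B)); rewrite /f.
  have := rmu_ge0 mu (actset A E); have := rmu_ge0 mu E; nra.
by apply: petridis => // Z mZ ZE; apply: Emax; split => //; exact: subset_trans EB.
Qed.

(** Iterating Petridis's inequality from the maximiser E gives
   mu(A^k E) <= K^k mu(E) <= K^k mu(B) for each K > mu(AB) / mu(B).  When A^k
   moves every non-null set onto almost everything the left-hand side is 1, and
   K tends to mu(AB) / mu(B). *)
Theorem measure_pluennecke (A : set G) (k : nat) (B : set X) :
  (0 < k)%N -> measurable B -> 0 < m B ->
  (forall E, measurable E -> 0 < m E -> m (actset (nsumset A k) E) = 1) ->
  m B ^+ k.-1 <= m (actset A B) ^+ k.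
Proof.
move=> k0 mB B0 erg.
have K_ge1 K : 0 <= K -> m (actset A B) < K * m B -> 1 <= K ^+ k * m B.
  move=> K0 KB; have [E [mE EB E0 Eext]] := pluennecke_maximiser mB K0 KB.
  rewrite -(erg _ mE E0).
  apply: (@le_trans _ _ (K ^+ k * m E)); last first.
    by rewrite ler_wpM2l ?exprn_ge0 //; exact: le_rmu.
  elim: {k0 erg} k => [|j IH].
    by rewrite expr0 mul1r /nsumset /= actset1 (rmu_act Gact).
  rewrite /nsumset iterS -/(nsumset A j) sumsetC -(actset_sumset Gact).
  by apply: le_trans (Eext _) _; rewrite exprS -mulrA ler_wpM2l.
pose r := m (actset A B) / m B.
have r0 : 0 <= r by rewrite divr_ge0 // rmu_ge0.
have c1 : (fun n : nat => r + n.+1%:R^-1) @ \oo --> r.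
  rewrite -[X in _ --> X]addr0.
  apply: cvgD; [exact: cvg_cst|exact: cvg_harmonic].
have c2 : (fun n : nat => (r + n.+1%:R^-1) ^+ k) @ \oo --> r ^+ k.
  exact: (continuous_cvg _ (@exprn_continuous _ k r) c1).
have c3 : (fun n : nat => (r + n.+1%:R^-1) ^+ k * m B) @ \oo --> r ^+ k * m B.
  exact: cvgMl.
have : 1 <= r ^+ k * m B.
  apply: (cvgr_to_ge c3); apply: nearW => n.
  have n0 : 0 < n.+1%:R^-1 :> R by rewrite invr_gt0.
  apply: K_ge1; first by rewrite addr_ge0 // ltW.
  by rewrite mulrDl /r divfK ?gt_eqF // ltrDl mulr_gt0.
rewrite /r expr_div_n; move: (m B) B0 (m _) => x x0 y.
have xk : 0 < x ^+ k.-1 by rewrite exprn_gt0.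
have -> : y ^+ k / x ^+ k * x = y ^+ k / x ^+ k.-1.
  rewrite -[in x ^+ k](prednK k0) exprS; field.
  by rewrite !gt_eqF.
by rewrite ler_pdivlMr // mul1r.
Qed.

End Pluennecke.

(** * Invariant means as functionals *)

Section MeansAsFunctionals.
Context {R : realType} {G : zmodType}.
Local Notation L := (linfty G R).
Implicit Types (f g : L) (phi : L -> R) (B C : set G).

Lemma linfty_eq f g : f =1 g -> f = g.
Proof. by move=> fg; apply: val_inj; apply: funext. Qed.

Lemma linfty_fun_bounded f : exists M, forall x, `|f x| <= M.
Proof. exact/bounded_predP/linfty_bounded. Qed.

Lemma linfty_scaleE a f x : (a *: f) x = a * f x.
Proof. by []. Qed.

Lemma linfty_oneE x : linfty_indic R [set: G] x = 1.
Proof. by rewrite /= indicT. Qed.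

(** Normalisation at the constant 1 is, for positive functionals, the same as norm
   one, and unlike the norm it passes to pointwise limits. *)
Record invmean phi : Prop := {
  invmean_linear : forall a f g, phi (a *: f + g) = a * phi f + phi g ;
  invmean_ge0 : forall f, (forall x, 0 <= f x) -> 0 <= phi f ;
  invmean1 : phi (linfty_indic R setT) = 1 ;
  invmean_translate : forall a f, phi (translate a f) = phi f }.

Section Theory.
Context phi (phim : invmean phi).

Lemma invmean0 : phi 0 = 0.
Proof.
have := invmean_linear phim 1 0 0.
by rewrite scale1r addr0 mul1r => /eqP; rewrite -subr_eq0 opprD addNKr oppr_eq0 => /eqP.
Qed.

Lemma invmeanZ a f : phi (a *: f) = a * phi f.
Proof. by rewrite -[a *: f]addr0 (invmean_linear phim) invmean0 addr0. Qed.

Lemma invmeanD f g : phi (f + g) = phi f + phi g.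
Proof. by rewrite -[f]scale1r (invmean_linear phim) !scale1r mul1r. Qed.

Lemma invmeanN f : phi (- f) = - phi f.
Proof. by rewrite -scaleN1r invmeanZ mulN1r. Qed.

Lemma invmeanB f g : phi (f - g) = phi f - phi g.
Proof. by rewrite invmeanD invmeanN. Qed.

Lemma le_invmean f g : (forall x, f x <= g x) -> phi f <= phi g.
Proof.
move=> fg; rewrite -subr_ge0 -invmeanB; apply: (invmean_ge0 phim) => x /=.
by rewrite subr_ge0.
Qed.

Lemma invmean_norm f M : (forall x, `|f x| <= M) -> `|phi f| <= M.
Proof.
move=> fM; rewrite -[M]mulr1 -(invmean1 phim) ler_norml -mulNr -!invmeanZ.
by apply/andP; split; apply: le_invmean => x; rewrite linfty_scaleE linfty_oneE;
  have := fM x; rewrite ler_norml mulr1 => /andP[].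
Qed.

End Theory.

Lemma linfty_norm_le1 f x : linfty_norm f <= 1 -> `|f x| <= 1.
Proof.
apply: le_trans; apply: ub_le_sup; last by exists x.
by have [M fM] := linfty_fun_bounded f; exists M => _ [y _ <-].
Qed.

Lemma indicT_norm_le1 : linfty_norm (linfty_indic R [set: G]) <= 1.
Proof.
apply: ge_sup; first by exists `|linfty_indic R [set: G] 0|, 0.
by move=> _ [x _ <-] /=; rewrite indicT normr1.
Qed.

Lemma invmean_of_mean (lambda : {scalar L}) :
  invariant_mean lambda -> invmean lambda.
Proof.
move=> [[pos norm1] inv]; split => //.
- by move=> a f g; rewrite linearP.
- set one := linfty_indic R _.
  have le_lambda f g : (forall x, f x <= g x) -> lambda f <= lambda g.
    by move=> fg; rewrite -subr_ge0 -linearB; apply: pos => x /=; rewrite subr_ge0.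
  (* A positive functional attains its norm at the constant 1. *)
  have le_one f : linfty_norm f <= 1 -> `|lambda f| <= lambda one.
    move=> f1; have fx x := linfty_norm_le1 x f1.
    rewrite ler_norml -linearN; apply/andP; split; apply: le_lambda => x;
      have := fx x; rewrite ler_norml => /andP[].
      by rewrite -[X in - X <= _](linfty_oneE x).
    by rewrite linfty_oneE.
  rewrite -[RHS]norm1; apply/eqP; rewrite eq_le; apply/andP; split.
    apply: ub_le_sup; first by exists (lambda one) => _ [f /le_one f1 <-].
    exists one; first exact: indicT_norm_le1.
    by rewrite ger0_norm // pos // => x; rewrite /= indicT.
  apply: ge_sup; last by move=> _ [f /le_one f1 <-].
  by exists `|lambda one|, one => //; exact: indicT_norm_le1.
Qed.

Lemma mean_of_invmean phi : invmean phi ->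
  exists lambda : {scalar L}, invariant_mean lambda /\ forall f, lambda f = phi f.
Proof.
move=> phim.
pose isl := GRing.isLinear.Build R L R _ phi (invmean_linear phim).
pose lambda : {scalar L} := HB.pack phi isl.
exists lambda; split => //; split; last exact: (invmean_translate phim).
split; first exact: (invmean_ge0 phim).
apply/eqP; rewrite eq_le; apply/andP; split.
  apply: ge_sup; first by exists `|phi (linfty_indic R setT)|, (linfty_indic R setT) => //; exact: indicT_norm_le1.
  by move=> _ [f f1 <-]; apply: (invmean_norm phim) => x; exact: linfty_norm_le1.
apply: ub_le_sup.
  by exists 1 => _ [f f1 <-]; apply: (invmean_norm phim) => x; exact: linfty_norm_le1.
exists (linfty_indic R setT); first exact: indicT_norm_le1.
by rewrite /= (invmean1 phim) normr1.
Qed.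

Definition meas phi B : R := phi (linfty_indic R B).

Lemma upper_densityE B :
  upper_density R B = sup [set meas phi B | phi in invmean].
Proof.
congr sup; apply/seteqP; split => _ [l lm <-].
  by exists l => //; exact: invmean_of_mean.
by have [lambda [lambdam lE]] := mean_of_invmean lm; exists lambda.
Qed.

Lemma lower_densityE B :
  lower_density R B = inf [set meas phi B | phi in invmean].
Proof.
congr inf; apply/seteqP; split => _ [l lm <-].
  by exists l => //; exact: invmean_of_mean.
by have [lambda [lambdam lE]] := mean_of_invmean lm; exists lambda.
Qed.

Lemma ulim_near_cvg (u v : nat -> R) (l : R) :
  natU [set n | v n = u n] -> v @ natU --> l -> ulim u = l.
Proof.
move=> uv vl; apply: ulim_cvg; apply: cvg_trans vl; apply: near_eq_cvg.
exact: uv.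
Qed.

Lemma invmean_uclosed : uclosed invmean.
Proof.
move=> Phi PhiK.
have bnd f : exists M, natU [set n | `|Phi n f| <= M].
  have [M fM] := linfty_fun_bounded f; exists M.
  by apply: filterS PhiK => n Phim; exact: invmean_norm.
have cv f : (fun n => Phi n f) @ natU --> plim Phi f.
  by have [M] := bnd f; exact: cvg_ulim.
split.
- move=> a f g.
  have c : (fun n => a * Phi n f + Phi n g) @ natU --> a * plim Phi f + plim Phi g.
    by apply: cvgD => //; exact: cvgMr.
  apply: ulim_near_cvg c.
  by apply: filterS PhiK => n Phim; rewrite /= (invmean_linear Phim).
- move=> f f0; apply: (cvgr_to_ge (cv f)).
  by apply: filterS PhiK => n Phim; exact: (invmean_ge0 Phim).
- apply: (ulim_near_cvg _ (cvg_cst (1 : R))).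
  by apply: filterS PhiK => n Phim; rewrite /= (invmean1 Phim).
- move=> a f; apply: ulim_near_cvg (cv f).
  by apply: filterS PhiK => n Phim; rewrite /= (invmean_translate Phim).
Qed.

Lemma invmean_coord f : ucontinuous invmean (fun phi => phi f).
Proof.
have [M fM] := linfty_fun_bounded f.
by apply: (@ucontinuous_coord _ _ _ _ M) => phi phim; exact: invmean_norm.
Qed.

End MeansAsFunctionals.

(** * The shift on configurations *)

Section Configurations.
Context (G : zmodType).

Definition config := G -> bool.

HB.instance Definition _ := gen_eqMixin config.
HB.instance Definition _ := gen_choiceMixin config.
HB.instance Definition _ := isPointed.Build config (fun=> false).

(** Sets of configurations that depend on finitely many coordinates: the clopen
   subsets of the Cantor space {0, 1}^G, described without its topology. *)
Definition cylinder : set (set config) := [set C |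
  exists s : seq G, forall y z, (forall g, g \in s -> y g = z g) -> C y -> C z].

Lemma cylinder0 : cylinder set0.
Proof. by exists [::]. Qed.

Lemma cylinderU : setU_closed cylinder.
Proof.
move=> C D [s Cs] [t Dt]; exists (s ++ t) => y z yz [Cy|Dy]; [left|right].
  by apply: Cs Cy => g gs; apply: yz; rewrite mem_cat gs.
by apply: Dt Dy => g gs; apply: yz; rewrite mem_cat gs orbT.
Qed.

Lemma cylinderC : setC_closed cylinder.
Proof.
move=> C [s Cs]; exists s => y z yz nCy Cz; apply: nCy.
by apply: Cs Cz => g gs; rewrite yz.
Qed.

Definition cylinder_display : measure_display.
Proof. exact: default_measure_display. Qed.

HB.instance Definition _ :=
  isAlgebraOfSets.Build cylinder_display config cylinder0 cylinderU cylinderC.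

(** Compactness of {0, 1}^G: a pointwise ultrafilter limit z of points y n of C n
   agrees with y n on any given finite set of coordinates, for natU-almost all n,
   and therefore belongs to every C m. *)
Lemma cylinder_compact (C : nat -> set config) : (forall n, cylinder (C n)) ->
  (forall m n, (m <= n)%N -> C n `<=` C m) -> (forall n, C n !=set0) ->
  \bigcap_n C n !=set0.
Proof.
move=> Ccyl Cdec /choice[y Cy].
pose z g := `[< natU [set n | y n g] >].
have near_z g : natU [set n | y n g = z g].
  have [yg|yg] := in_ultra_setVsetC [set n | y n g] natU_ultra.
    have -> : z g = true by apply/asboolT.
    exact: yg.
  have -> : z g = false.
    by apply/asboolF => /(filterI yg)/filter_ex[n []].
  by apply: filterS yg => n /= /negP/negbTE.
have near_zs (s : seq G) : natU [set n | forall g, g \in s -> y n g = z g].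
  elim: s => [|g s IH]; first exact: filterS filterT.
  apply: filterS2 (near_z g) IH => n /= yg ys h.
  by rewrite inE => /predU1P[->|/ys].
exists z => m _; have [s Cs] := Ccyl m.
have : natU [set n | (m <= n)%N] by apply: natU_eventually; exists m.
move=> /(filterI (near_zs s))/filter_ex[n /= [yz mn]].
by apply: Cs yz _; exact: Cdec (Cy n).
Qed.

Definition shift (g : G) (y : config) : config := fun h => y (h - g).

Lemma shift0 y : shift 0 y = y.
Proof. by apply: funext => h; rewrite /shift subr0. Qed.

Lemma shiftD g h y : shift (g + h) y = shift g (shift h y).
Proof. by apply: funext => k; rewrite /shift opprD addrA. Qed.

Lemma cylinder_shift g C : cylinder C -> cylinder (shift g @^-1` C).
Proof.
move=> [s Cs]; exists [seq h - g | h <- s] => y z yz.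
by apply: Cs => h hs; apply: yz; apply/mapP; exists h.
Qed.

(** Coordinate h of the itinerary of x tells whether x lies in h + B.  This
   equivariant map from G to the configurations transports means to measures. *)
Definition itinerary (B : set G) (x : G) : config := fun h => `[< B (x - h) >].

Lemma itineraryD B x g : itinerary B (x + g) = shift g (itinerary B x).
Proof.
by apply: funext => h; rewrite /itinerary /shift opprB addrA.
Qed.

End Configurations.

(** * The measure defined by an invariant mean *)

Section Premeasure.
Context {R : realType} {G : zmodType}.

(** Bundled, so that the measure structure below can be attached to the mean. *)
Record invMean := InvMean {
  invMean_fun :> linfty G R -> R ;
  invMeanP : invmean invMean_fun }.

Implicit Types (l : invMean) (B C : set G).

Lemma meas0 l : meas l set0 = 0.
Proof.
rewrite /meas -(invmean0 (invMeanP l)); congr (invMean_fun l _).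
by apply: linfty_eq => x /=; rewrite indic0.
Qed.

Lemma measT l : meas l setT = 1.
Proof. exact: (invmean1 (invMeanP l)). Qed.

Lemma meas_ge0 l B : 0 <= meas l B.
Proof. by apply: (invmean_ge0 (invMeanP l)) => x; rewrite /= indicE. Qed.

Lemma le_meas l B C : B `<=` C -> meas l B <= meas l C.
Proof.
move=> BC; apply: (le_invmean (invMeanP l)) => x /=.
rewrite /= !indicE; have [/set_mem/BC/mem_set->//|_] := boolP (x \in B).
by rewrite ler0n.
Qed.

Lemma meas_disjoint l B C : B `&` C = set0 ->
  meas l (B `|` C) = meas l B + meas l C.
Proof.
move=> BC; rewrite /meas -(invmeanD (invMeanP l)); congr (invMean_fun l _).
apply: linfty_eq => x; change (\1_(B `|` C) x = \1_B x + \1_C x :> R).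
rewrite !indicE in_setU.
have [/set_mem Bx|_] := boolP (x \in B); last by rewrite add0r.
rewrite memNset ?addr0 // => Cx.
by have : set0 x by rewrite -BC.
Qed.

Definition premeasure l B (C : set (config G)) : \bar R :=
  (meas l (itinerary B @^-1` C))%:E.

Lemma premeasure0 l B : premeasure l B set0 = 0%E.
Proof. by rewrite /premeasure preimage_set0 meas0. Qed.

Lemma premeasure_ge0 l B (C : set (config G)) : (0 <= premeasure l B C)%E.
Proof. by rewrite lee_fin meas_ge0. Qed.

(** A countable partition of a cylinder into cylinders is finite up to empty
   pieces, by compactness; so a finitely additive mean becomes countably
   additive on cylinders. *)
Lemma premeasure_sigma_additive l B : semi_sigma_additive (premeasure l B).
Proof.
move=> F mF tF mU.
pose P n := \bigcup_(i < n) F i.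
have PS n : P n.+1 = P n `|` F n.
  by rewrite /P !bigcup_mkord big_ord_recr.
have sumP n : (\sum_(0 <= i < n) premeasure l B (F i) = premeasure l B (P n))%E.
  elim: n => [|n IH]; first by rewrite big_geq // /P bigcup_mkord big_ord0 premeasure0.
  rewrite big_nat_recr //= IH PS /premeasure -EFinD preimage_setU meas_disjoint //.
  rewrite -preimage_setI; apply/seteqP; split => // x /= [[i /= ni Fi] Fn].
  by move/trivIsetP : tF => /(_ i n Logic.I Logic.I); rewrite ltn_eqF // => /(_ isT) FF;
    rewrite /set0 /= -[False]/(set0 (itinerary B x)) -FF.
have cylP n : cylinder (P n).
  elim: n => [|n IH]; first by rewrite /P bigcup_mkord big_ord0; exact: cylinder0.
  by rewrite PS; apply: cylinderU => //; exact: mF.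
have [N PN] : exists N, (\bigcup_n F n) `\` P N = set0.
  apply: contrapT => /forallNP nP.
  have [||n|z zP] := @cylinder_compact G (fun n => (\bigcup_n F n) `\` P n).
  - by move=> n; exact: (@measurableD _ (config G) _ _ mU (cylP n)).
  - move=> m n mn y [Uy nPy]; split => // -[i /= im Fi]; apply: nPy.
    by exists i => //=; exact: leq_trans mn.
  - by apply/set0P/eqP; exact: nP.
  - have [[n _ Fn] _] := zP 0%N Logic.I.
    by have [_] := zP n.+1 Logic.I; apply; exists n => /=.
apply: cvg_near_cst; exists N => // n /= Nn; rewrite sumP; congr (premeasure _ _ _).
apply/seteqP; split => [y [i _ Fi]|y Uy]; first by exists i.
have : P N y by apply: contrapT => nP; have : set0 y by rewrite -PN.
by move=> [i /= iN Fi]; exists i => //=; exact: leq_trans Nn.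
Qed.

HB.instance Definition _ l B := isMeasure.Build _ _ _ (premeasure l B)
  (premeasure0 l B) (premeasure_ge0 l B) (@premeasure_sigma_additive l B).

Definition shift_measure l B := measure_extension (premeasure l B).

HB.instance Definition _ l B := Measure.on (shift_measure l B).

Lemma shift_measureE l B (C : set (config G)) : cylinder C ->
  shift_measure l B C = premeasure l B C.
Proof. by move=> cC; rewrite /shift_measure /measure_extension measurable_mu_extE. Qed.

Lemma shift_measure_setT l B : shift_measure l B setT = 1%E.
Proof.
rewrite shift_measureE; last exact: (@measurableT _ (config G)).
by rewrite /premeasure preimage_setT measT.
Qed.

HB.instance Definition _ l B := Measure_isProbability.Build _ _ _
  (shift_measure l B) (shift_measure_setT l B).

End Premeasure.

(** * Separability of L2 from a countable dense family of sets *)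

Section SeparableL2.
Context {R : realType} {d : measure_display} {X : measurableType d}.
Context (mu : probability X R).
Implicit Types (f g h u v : X -> R).

(** The square of the L2 norm; being an integral of a nonnegative function, it can
   be estimated through (a + b)^2 <= 2 a^2 + 2 b^2 with no integrability side
   conditions. *)
Definition meansq f : \bar R := (\int[mu]_x ((f x) ^+ 2)%:E)%E.

Lemma measurable_sq f : measurable_fun setT f ->
  measurable_fun setT ((fun x => ((f x) ^+ 2)%:E) : X -> \bar R).
Proof. by move=> mf; apply/measurable_EFinP; exact: measurable_funX. Qed.

Lemma meansq_ge0 f : (0 <= meansq f)%E.
Proof. by apply: integral_ge0 => x _; rewrite lee_fin sqr_ge0. Qed.

Lemma le_meansq f g : measurable_fun setT f -> measurable_fun setT g ->
  (forall x, `|f x| <= `|g x|) -> (meansq f <= meansq g)%E.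
Proof.
move=> mf mg fg; apply: ge0_le_integral => //.
- by move=> x _; rewrite lee_fin sqr_ge0.
- exact: measurable_sq.
- exact: measurable_sq.
- move=> x _; rewrite lee_fin -[f x ^+ 2]real_normK ?num_real //.
  by rewrite -[g x ^+ 2]real_normK ?num_real // ler_sqr ?nnegrE.
Qed.

Lemma meansqD_le f g : measurable_fun setT f -> measurable_fun setT g ->
  (meansq (f \+ g)%R <= 2%:E * meansq f + 2%:E * meansq g)%E.
Proof.
move=> mf mg; rewrite /meansq.
have sq0 h x : (0 <= (h x ^+ 2)%R%:E :> \bar R)%E by rewrite lee_fin sqr_ge0.
have sq20 h x : (0 <= 2%:E * (h x ^+ 2)%R%:E :> \bar R)%E by rewrite mule_ge0 // lee_fin.
rewrite -!ge0_integralZl_EFin //; [|exact: measurable_sq..].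
rewrite -ge0_integralD //; [|by apply: measurable_funeM; exact: measurable_sq..].
apply: ge0_le_integral => //.
- by apply: measurable_sq; exact: measurable_funD.
- by apply: emeasurable_funD; apply: measurable_funeM; exact: measurable_sq.
- move=> x _ /=; rewrite -!EFinM -EFinD lee_fin.
  by rewrite -subr_ge0; have := sqr_ge0 (f x - g x); congr (0 <= _); ring.
Qed.

Lemma meansqN f : meansq (fun x => - f x) = meansq f.
Proof. by apply: eq_integral => x _; rewrite sqrrN. Qed.

Lemma meansq_cst_le (c : R) f : measurable_fun setT f ->
  (forall x, `|f x| <= c) -> (meansq f <= (c ^+ 2)%:E)%E.
Proof.
move=> mf fc; apply: (@le_trans _ _ (meansq (cst c))).
  by apply: le_meansq => // x; rewrite (le_trans (fc x)) // ler_norm.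
have -> : meansq (cst c) = (\int[mu]_x cst ((c ^+ 2)%R%:E) x)%E by [].
by rewrite integral_cst //= (@probability_setT _ _ _ mu) mule1.
Qed.

Lemma Lnorm2E f : ('N[mu]_2%:E[EFin \o f] = (meansq f) `^ 2^-1)%E.
Proof.
rewrite unlock /Lnorm; congr (_ `^ _)%E; apply: eq_integral => x _ /=.
by rewrite powR_mulrn // -normrX ger0_norm // sqr_ge0.
Qed.

Lemma Lnorm2_lt f (e : R) : 0 < e -> (meansq f < (e ^+ 2)%:E)%E ->
  ('N[mu]_2%:E[EFin \o f] < e%:E)%E.
Proof.
move=> e0; rewrite Lnorm2E; have := meansq_ge0 f.
case: (meansq f) => [r| |] //=; rewrite !lee_fin !lte_fin => r0 re.
rewrite -[e]ger0_norm ?(ltW e0) // -sqrtr_sqr -powR12_sqrt ?sqr_ge0 //.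
by rewrite gt0_ltr_powR // ?nnegrE // ?sqr_ge0.
Qed.

Lemma Lfun2P f :
  f \in Lfun mu 2%:E <-> measurable_fun setT f /\ (meansq f < +oo)%E.
Proof.
split=> [fL|[mf fI]].
  split; first by have := sub_Lfun_mfun fL; rewrite inE.
  have /integrableP[_] := Lfun2_integrable_sqr fL.
  congr (_ < _)%E; apply: eq_integral => x _ /=.
  by rewrite ger0_norm // sqr_ge0.
rewrite inE /=; apply/andP; split; first by rewrite inE.
rewrite inE /= /finite_norm Lnorm2E; exact: poweR_lty.
Qed.

Context (C : nat -> set X) (mC : forall n, measurable (C n)).
Hypothesis dense : forall E, measurable E -> forall e : R, 0 < e ->
  exists n, rmu mu ((E `\` C n) `|` (C n `\` E)) < e.

Definition rational_step (s : seq (rat * nat)) : X -> R :=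
  fun x => \sum_(p <- s) ratr p.1 * \1_(C p.2) x.

Lemma measurable_rational_step s : measurable_fun setT (rational_step s).
Proof.
apply: measurable_sum => p; apply: measurable_funM => //.
Qed.

Lemma rational_step_Lfun s : rational_step s \in Lfun mu 2%:E.
Proof.
apply/Lfun2P; split; first exact: measurable_rational_step.
pose c := \sum_(p <- s) `|ratr p.1 : R|.
apply: (@le_lt_trans _ _ (c ^+ 2)%:E); last by rewrite ltry.
apply: meansq_cst_le; first exact: measurable_rational_step.
move=> x; apply: le_trans (ler_norm_sum _ _ _) _; apply: ler_sum => p _.
by rewrite normrM ler_piMr // indicE; case: (_ \in _); rewrite ?normr1 ?normr0.
Qed.

Definition steps_dense f := measurable_fun setT f /\
  forall e : R, 0 < e -> exists s,
    (meansq (fun x => (f x - rational_step s x)%R) < e%:E)%E.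

Lemma steps_denseD f g : steps_dense f -> steps_dense g ->
  steps_dense (f \+ g).
Proof.
move=> [mf df] [mg dg]; split; first exact: measurable_funD.
move=> e e0; have e4 : 0 < e / 4 by rewrite divr_gt0.
have [s sf] := df _ e4; have [t tg] := dg _ e4.
exists (s ++ t); have ms := measurable_rational_step.
have -> : (fun x => (f \+ g) x - rational_step (s ++ t) x) =
    (fun x => f x - rational_step s x) \+ (fun x => g x - rational_step t x).
  by apply: funext => x /=; rewrite /rational_step big_cat /=; ring.
apply: le_lt_trans (meansqD_le _ _) _; [exact: measurable_funB..|].
have -> : e%:E = (2%:E * (e / 4)%:E + 2%:E * (e / 4)%:E)%E.
  by rewrite -!EFinM -EFinD; congr EFin; field.
by apply: lteD; rewrite lte_pmul2l.
Qed.

Lemma steps_denseN f : steps_dense f -> steps_dense (fun x => - f x).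
Proof.
move=> [mf df]; split; first exact: measurable_funN.
move=> e e0; have [s sf] := df _ e0.
exists [seq (- p.1, p.2) | p <- s].
have -> : (fun x => - f x - rational_step [seq (- p.1, p.2) | p <- s] x) =
    (fun x => - (f x - rational_step s x)).
  apply: funext => x; rewrite opprB [RHS]addrC; congr (_ + _).
  rewrite /rational_step big_map -sumrN; apply: eq_bigr => p _ /=.
  by rewrite rmorphN mulNr opprK.
by rewrite meansqN.
Qed.

(** Replace a by a nearby rational q and E by a nearby C n: the first change costs
   at most (a - q)^2 and the second q^2 times the measure of the symmetric
   difference. *)
Lemma steps_dense_indic (a : R) E : measurable E ->
  steps_dense (fun x => a * \1_E x).
Proof.
move=> mE; split; first by apply: measurable_funM.
move=> e e0; pose dl := Num.min 1 (e / 8).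
have dl0 : 0 < dl by rewrite lt_min ltr01 divr_gt0.
have dl2 : dl ^+ 2 <= e / 8.
  have : dl <= 1 by rewrite ge_min lexx.
  have : dl <= e / 8 by rewrite ge_min lexx orbT.
  nra.
have [q /andP[aq qa]] : exists q : rat, a < ratr q < a + dl.
  have [|q] := @rat_in_itvoo R a (a + dl); first by rewrite ltrDl.
  by rewrite in_itv /=; exists q.
have q1 : 0 < (ratr q : R) ^+ 2 + 1 by rewrite ltr_wpDl ?sqr_ge0.
have [|n Cn] := dense mE (e := e / (8 * ((ratr q) ^+ 2 + 1))).
  by rewrite divr_gt0 // mulr_gt0.
have mED : measurable ((E `\` C n) `|` (C n `\` E)).
  by apply: measurableU; apply: measurableD.
exists [:: (q, n)].
have -> : (fun x => a * \1_E x - rational_step [:: (q, n)] x) =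
  (fun x => (a - ratr q) * \1_E x) \+ (fun x => ratr q * (\1_E x - \1_(C n) x)).
  by apply: funext => x; rewrite /rational_step big_seq1 /=; ring.
have m1 : measurable_fun setT (fun x => (a - ratr q) * \1_E x).
  exact: measurable_funM.
have m2 : measurable_fun setT (fun x => ratr q * (\1_E x - \1_(C n) x) : R).
  by apply: measurable_funM => //; exact: measurable_funB.
apply: le_lt_trans (meansqD_le m1 m2) _.
have i1 : (meansq (fun x => ((a - ratr q) * \1_E x)%R) <= (e / 8)%:E)%E.
  apply: (@le_trans _ _ (dl ^+ 2)%:E); last by rewrite lee_fin.
  apply: meansq_cst_le => // x; rewrite normrM.
  apply: (@le_trans _ _ `|a - ratr q|).
    by rewrite ler_piMr // indicE; case: (_ \in _); rewrite ?normr1 ?normr0.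
  by rewrite ler_norml; apply/andP; split; lra.
have i2 : (meansq (fun x => (ratr q * (\1_E x - \1_(C n) x))%R) <= (e / 8)%:E)%E.
  have -> : meansq (fun x => (ratr q * (\1_E x - \1_(C n) x))%R) =
     (\int[mu]_x (((ratr q) ^+ 2)%R%:E *
       (\1_((E `\` C n) `|` (C n `\` E)) x)%:E))%E.
    apply: eq_integral => x _; rewrite -EFinM; congr EFin.
    rewrite !indicE in_setU !in_setD.
    by case: (x \in E); case: (x \in C n) => /=; ring.
  rewrite ge0_integralZl_EFin ?sqr_ge0 //; last first.
    by apply/measurable_EFinP.
  rewrite integral_indic // setIT.
  have le8 : ratr q ^+ 2 * rmu mu ((E `\` C n) `|` (C n `\` E)) <= e / 8.
    rewrite ltW //; move: Cn; rewrite ltr_pdivlMr ?mulr_gt0 //.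
    have := rmu_ge0 mu ((E `\` C n) `|` (C n `\` E)); have := sqr_ge0 (ratr q : R).
    by set r := rmu mu _; set t := ratr q ^+ 2; rewrite ltr_pdivlMr; nra.
  by move: le8; rewrite -lee_fin EFinM -(@rmuE _ _ _ mu _ mED).
apply: (@le_lt_trans _ _ (2%:E * (e / 8)%:E + 2%:E * (e / 8)%:E)%E).
  by apply: leeD; (apply: lee_wpmul2l; first by rewrite lee_fin).
by rewrite -!EFinM -EFinD lte_fin; lra.
Qed.

Lemma steps_dense_sum (I : Type) (r : seq I) (F : I -> X -> R) :
  (forall i, steps_dense (F i)) -> steps_dense (fun x => \sum_(i <- r) F i x).
Proof.
move=> dF; elim: r => [|i r IH].
  have -> : (fun x => \sum_(i <- [::]) F i x) = (fun x => 0 * \1_set0 x).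
    by apply: funext => x; rewrite big_nil mul0r.
  exact: steps_dense_indic.
have -> : (fun x => \sum_(j <- i :: r) F j x) = F i \+ (fun x => \sum_(i <- r) F i x).
  by apply: funext => x; rewrite big_cons.
exact: steps_denseD.
Qed.

Lemma steps_dense_closed f : measurable_fun setT f ->
  (forall e : R, 0 < e -> exists2 g, steps_dense g &
     (meansq (fun x => (f x - g x)%R) < e%:E)%E) -> steps_dense f.
Proof.
move=> mf df; split => // e e0; have e4 : 0 < e / 4 by rewrite divr_gt0.
have [g [mg dg] fg] := df _ e4; have [s sg] := dg _ e4; exists s.
have ms := measurable_rational_step.
have -> : (fun x => f x - rational_step s x) =
    (fun x => f x - g x) \+ (fun x => g x - rational_step s x).
  by apply: funext => x /=; ring.
apply: le_lt_trans (meansqD_le _ _) _; [exact: measurable_funB..|].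
have -> : e%:E = (2%:E * (e / 4)%:E + 2%:E * (e / 4)%:E)%E.
  by rewrite -!EFinM -EFinD; congr EFin; field.
by apply: lteD; rewrite lte_pmul2l.
Qed.

Import HBNNSimple.

(** The simple functions g n increase to f, so (f - g n)^2 is dominated by f^2 and
   tends to 0. *)
Lemma steps_dense_ge0 f : measurable_fun setT f -> (forall x, 0 <= f x) ->
  (meansq f < +oo)%E -> steps_dense f.
Proof.
move=> mf f0 fI; apply: steps_dense_closed => // e e0.
have mEf : measurable_fun [set: X] (EFin \o f : X -> \bar R).
  exact/measurable_EFinP.
pose g n := nnsfun_approx measurableT mEf n.
have gf n x : 0 <= g n x <= f x.
  apply/andP; split => //; rewrite -lee_fin /g nnsfun_approxE.
  by apply: le_approx => // y _; rewrite lee_fin.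
have cvg_g x : (fun n => g n x) @ \oo --> f x.
  have := @cvg_nnsfun_approx _ _ _ _ measurableT _ mEf.
  move=> /(_ (fun x _ => f0 x) x Logic.I) /=.
  by move/fine_cvgP => -[_]; exact.
have mg n : measurable_fun setT (fun x => f x - g n x) by exact: measurable_funB.
have [] := @dominated_convergence _ _ _ mu _ measurableT
   (fun n x => ((f x - g n x) ^+ 2)%:E) (cst 0%E) (fun x => ((f x) ^+ 2)%:E).
- by move=> n; exact: measurable_sq.
- exact: measurable_cst.
- apply: aeW => x _; apply: cvg_EFin; first exact: nearW.
  have c : (fun n => f x - g n x) @ \oo --> 0.
    by rewrite -(subrr (f x)); apply: cvgB; [exact: cvg_cst|exact: cvg_g].
  by rewrite -[X in _ --> X](mulr0 (0 : R)); exact: (cvgM c c).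
- apply/integrableP; split; first exact: measurable_sq.
  apply: le_lt_trans fI; rewrite le_eqVlt; apply/orP; left; apply/eqP.
  by apply: eq_integral => x _; rewrite gee0_abs // lee_fin sqr_ge0.
- apply: aeW => x n _; rewrite gee0_abs ?lee_fin ?sqr_ge0 //.
  by have /andP[] := gf n x; nra.
move=> _ _; rewrite integral0 => /= /fine_cvgP[fin c].
have lt_e : \forall n \near \oo, fine (meansq (fun x => f x - g n x)) < e.
  by apply: (cvgr_lt _ c).
have [n /= [nfin ne]] := filter_ex (filterI fin lt_e).
exists (g n : X -> R); last first.
  by rewrite /meansq -(fineK nfin) lte_fin.
have -> : (g n : X -> R) = (fun x => \sum_(i < #|` fset_set (g n @` setT)|)
    ((fset_set (g n @` setT))`_i * \1_(g n @^-1` [set (fset_set (g n @` setT))`_i]) x)).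
  by apply: funext => x; exact: fimfunEord.
apply: steps_dense_sum => i; apply: steps_dense_indic.
rewrite -[X in measurable X]setTI; apply: (@measurable_funPT _ _ _ _ (g n)) => //.
Qed.

Theorem separable_L2_of_dense : separable_L2 mu.
Proof.
exists (range rational_step); split.
- apply: card_le_trans (card_image_le _ _) _; exact: countableP.
- by move=> _ [s _ <-]; exact: rational_step_Lfun.
move=> f /Lfun2P[mf fI] e e0.
pose p := (fun x => Num.max (f x) 0); pose q := (fun x => Num.max (- f x) 0).
have mp : measurable_fun setT p by exact: measurable_maxr.
have mq : measurable_fun setT q by apply: measurable_maxr => //; exact: measurable_funN.
have dp : steps_dense p.
  apply: steps_dense_ge0 => //; first by move=> x; rewrite le_max lexx orbT.
  apply: le_lt_trans fI; apply: le_meansq => // x; rewrite /p.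
  by case: (lerP (f x) 0) => _ //; rewrite normr0.
have dq : steps_dense q.
  apply: steps_dense_ge0 => //; first by move=> x; rewrite le_max lexx orbT.
  apply: le_lt_trans fI; apply: le_meansq => // x; rewrite /q.
  by case: (lerP (- f x) 0) => _ //; rewrite ?normr0 ?normrN.
have [_ /(_ (e ^+ 2))] := steps_denseD dp (steps_denseN dq).
case; first by rewrite exprn_gt0.
move=> s sf; exists (rational_step s); first by exists s.
apply: Lnorm2_lt => //; move: sf; congr (_ < _)%E; congr meansq.
apply: funext => x /=; congr (_ - _); rewrite /p /q.
by case: (lerP (f x) 0); case: (lerP (- f x) 0); lra.
Qed.

End SeparableL2.

(** * Approximation in the measure algebra *)

Definition symdiff {T : Type} (E F : set T) := (E `\` F) `|` (F `\` E).

Section SymmetricDifference.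
Context {R : realType} {d : measure_display} {X : measurableType d}.
Context (mu : probability X R).
Implicit Types E F C D : set X.

Lemma measurable_symdiff E F : measurable E -> measurable F ->
  measurable (symdiff E F).
Proof. by move=> mE mF; apply: measurableU; exact: measurableD. Qed.

Lemma symdiffC E F : symdiff E F = symdiff F E.
Proof. by rewrite /symdiff setUC. Qed.

Lemma symdiff_setC E F : symdiff (~` E) (~` F) = symdiff E F.
Proof. by rewrite /symdiff !setDE !setCK setUC !(setIC (~` _)). Qed.

Lemma symdiff_trans D E F : symdiff E F `<=` symdiff E D `|` symdiff D F.
Proof.
move=> x; rewrite /symdiff; case: (pselect (D x)) => Dx [] [? ?].
- by right; left.
- by left; right.
- by left; left.
- by right; right.
Qed.

Lemma le_symdiff_trans D E F : measurable D -> measurable E -> measurable F ->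
  rmu mu (symdiff E F) <= rmu mu (symdiff E D) + rmu mu (symdiff D F).
Proof.
move=> mD mE mF; have ms := measurable_symdiff.
apply: le_trans (le_rmuU _ _ _); [|exact: ms..].
apply: le_rmu; [exact: ms|by apply: measurableU; exact: ms|].
exact: symdiff_trans.
Qed.

Lemma dist_rmu_le E F : measurable E -> measurable F ->
  `|rmu mu E - rmu mu F| <= rmu mu (symdiff E F).
Proof.
move=> mE mF; have mS := measurable_symdiff mE mF.
have le1 E' F' : measurable E' -> measurable F' ->
    measurable (symdiff E' F') -> rmu mu E' <= rmu mu F' + rmu mu (symdiff E' F').
  move=> mE' mF' mS'; apply: le_trans (le_rmuU _ mF' mS').
  apply: le_rmu => //; first exact: measurableU.
  by move=> x E'x; case: (pselect (F' x)) => F'x; [left|right; left].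
rewrite ler_norml; have := le1 _ _ mE mF mS.
have := le1 _ _ mF mE; rewrite symdiffC => /(_ mS).
by move=> ? ?; apply/andP; split; lra.
Qed.

Lemma symdiffI_sub C E F : symdiff (E `&` C) (F `&` C) `<=` symdiff E F.
Proof.
by move=> x [] [[? ?] n]; [left|right]; split => // ?; apply: n.
Qed.

(** If the sets generating the sigma-algebra form an algebra, they are dense in
   the measure algebra: the approximable sets form a sigma-algebra. *)
Lemma measure_algebra_dense (C : set (set X)) :
  measurable = <<s C >> -> C set0 -> setU_closed C -> setC_closed C ->
  forall E, measurable E -> forall e : R, 0 < e ->
    exists2 D, C D & rmu mu (symdiff E D) < e.
Proof.
move=> mC C0 CU CC; pose H := [set E | measurable E /\ forall e : R, 0 < e ->
    exists2 D, C D & rmu mu (symdiff E D) < e].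
have CM D : C D -> measurable D by rewrite mC; exact: sub_gen_smallest.
have HU E F : H E -> H F -> H (E `|` F).
  move=> [mE HE] [mF HF]; split; first exact: measurableU.
  move=> e e0; have e2 : 0 < e / 2 by rewrite divr_gt0.
  have [D CD ED] := HE _ e2; have [D' CD' FD'] := HF _ e2.
  exists (D `|` D'); first exact: CU.
  have mS1 := measurable_symdiff mE (CM _ CD).
  have mS2 := measurable_symdiff mF (CM _ CD').
  apply: (@le_lt_trans _ _ (rmu mu (symdiff E D `|` symdiff F D'))).
    apply: le_rmu; [|exact: measurableU|].
      by apply: measurable_symdiff; apply: measurableU => //; exact: CM.
    move=> x [[[Ex|Fx] n]|[[Dx|D'x] n]].
    - by left; left; split => // ?; apply: n; left.
    - by right; left; split => // ?; apply: n; right.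
    - by left; right; split => // ?; apply: n; left.
    - by right; right; split => // ?; apply: n; right.
  apply: le_lt_trans (le_rmuU _ mS1 mS2) _.
  by rewrite (splitr e); exact: ltrD.
suff HM : <<s C >> `<=` H by move=> E; rewrite {1}mC => /HM[].
apply: smallest_sub; last first.
  move=> D CD; split; first exact: CM.
  by move=> e e0; exists D => //; rewrite /symdiff setDv setU0 rmu0.
split.
- by split => // e e0; exists set0 => //; rewrite /symdiff setDv setU0 rmu0.
- move=> E [mE HE]; rewrite setTD; split; first exact: measurableC.
  move=> e e0; have [D CD ED] := HE _ e0; exists (~` D); first exact: CC.
  by rewrite symdiff_setC.
- move=> F HF; have mF n : measurable (F n) by have [] := HF n.
  split; first exact: bigcupT_measurable.
  move=> e e0; have e2 : 0 < e / 2 by rewrite divr_gt0.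
  pose P n := \bigcup_(i < n) F i.
  have PS n : P n.+1 = P n `|` F n by rewrite /P !bigcup_mkord big_ord_recr.
  have HP n : H (P n).
    elim: n => [|n IH]; last by rewrite PS; exact: HU.
    rewrite /P bigcup_mkord big_ord0; split => // e' e'0.
    by exists set0 => //; rewrite /symdiff setDv setU0 rmu0.
  have mP n : measurable (P n) by have [] := HP n.
  have ndP : nondecreasing_seq P.
    move=> m n mn; rewrite subsetEset => x [i /= im Fi].
    by exists i => //=; exact: leq_trans mn.
  have UP : \bigcup_n F n = \bigcup_n P n.
    apply/seteqP; split => [x [n _ Fx]|x [n _ [i _ Fx]]]; last by exists i.
    by exists n.+1 => //; exists n => /=.
  have c := cvg_rmu_bigcup (mu := mu) mP ndP; rewrite -UP in c.
  have mU : measurable (\bigcup_n F n) by exact: bigcupT_measurable.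
  have [n nP] : exists n, rmu mu (\bigcup_n F n) - e / 2 < rmu mu (P n).
    have : \forall n \near \oo, rmu mu (\bigcup_n F n) - e / 2 < (rmu mu \o P) n.
      by apply: (cvgr_gt _ c); rewrite ltrBlDr ltrDl.
    by move=> /filter_ex[n]; exists n.
  have [_ /(_ _ e2)[D CD PD]] := HP n; exists D => //.
  apply: le_lt_trans (le_symdiff_trans (mP n) mU (CM _ CD)) _.
  rewrite (splitr e) ltrD // {1}/symdiff.
  have PU : P n `<=` \bigcup_n F n by rewrite UP; exact: bigcup_sup.
  rewrite (_ : P n `\` _ = set0) ?setU0; last by apply/seteqP; split => // x [/PU].
  by rewrite rmuD_sub //; lra.
Qed.

End SymmetricDifference.

(** * The shift as a measure preserving system *)

Section ShiftSystem.
Context {R : realType} {G : zmodType} (hG : countable [set: G]).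

(** A cylinder is given by finitely many coordinates and the list of words allowed
   there; coordinates are numbered through e, so that codes form a countable
   type. *)
Definition cylinder_code (e : nat -> G) (c : seq nat * seq (seq bool)) :
  set (config G) := [set y | [seq y (e i) | i <- c.1] \in c.2].

Lemma cylinder_cylinder_code e c : cylinder (cylinder_code e c).
Proof.
exists [seq e j | j <- c.1] => y z yz; rewrite /cylinder_code /=.
suff -> : [seq y (e j) | j <- c.1] = [seq z (e j) | j <- c.1] by [].
by apply/eq_in_map => j jc; apply: yz; rewrite map_f.
Qed.

Lemma cylinder_codeP e (C : set (config G)) : (forall g, exists n, e n = g) ->
  cylinder C -> exists c, C = cylinder_code e c.
Proof.
move=> /choice[r er] [s Cs].
have sE (y : config G) : [seq y (e j) | j <- map r s] = map y s.
  by rewrite -map_comp; apply: eq_map => g /=; rewrite er.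
pose L := map (@tval (size s) bool)
  (seq.filter (fun p => `[< exists2 y, C y & map y s = tval p >]) (enum {: (size s).-tuple bool})).
exists (map r s, L); apply/seteqP; split => y; rewrite /cylinder_code /= sE.
  move=> Cy; have sz : size (map y s) == size s by rewrite size_map.
  apply/mapP; exists (Tuple sz) => //; rewrite mem_filter mem_enum andbT.
  by apply/asboolP; exists y.
move=> /mapP[p]; rewrite mem_filter => /andP[/asboolP[z Cz zp] _] yp.
apply: Cs Cz => g gs; have : map z s = map y s by rewrite yp zp.
by move/eq_in_map => /(_ g gs).
Qed.

Lemma cylinder_enumeration : exists C : nat -> set (config G),
  (forall n, cylinder (C n)) /\ forall D, cylinder D -> exists n, C n = D.
Proof.
have [e esurj] := countable_enumeration hG.
exists (fun n => if @choice.unpickle (seq nat * seq (seq bool))%type n is Some c then cylinder_code e c else set0).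
split=> [n|D /(cylinder_codeP esurj)[c ->]].
  by case: choice.unpickle => [c|]; [exact: cylinder_cylinder_code|exact: cylinder0].
by exists (choice.pickle c); rewrite choice.pickleK.
Qed.

Local Notation X := (g_sigma_algebraType (@measurable _ (config G))).

Lemma measurable_cylinder (C : set (config G)) : cylinder C ->
  measurable (C : set X).
Proof. exact: sub_gen_smallest. Qed.

Lemma measurable_shift (g : G) : measurable_fun [set: X] (shift g : X -> X).
Proof.
apply: (@measurability _ _ X X [set: X] (shift g) (@cylinder G)) => // _ [C cC <-].
by rewrite setTI; apply: measurable_cylinder; exact: cylinder_shift.
Qed.

Lemma preimage_itinerary_shift (B : set G) g (C : set (config G)) :
  itinerary B @^-1` (shift g @^-1` C) = [set x | (itinerary B @^-1` C) (x + g)].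
Proof. by apply/seteqP; split => x /=; rewrite itineraryD. Qed.

Lemma image_shiftE g (C : set (config G)) : shift g @` C = shift (- g) @^-1` C.
Proof.
apply/seteqP; split => [_ [y Cy <-]|y Cy] /=.
  by rewrite -shiftD addNr shift0.
by exists (shift (- g) y) => //; rewrite -shiftD addrN shift0.
Qed.

Variables (l : @invMean R G) (B : set G).
Local Notation mu := (shift_measure l B).

Lemma meas_shift g (P : set G) : meas l [set x | P (x + g)] = meas l P.
Proof.
rewrite /meas -(invmean_translate (invMeanP l) (- g) (linfty_indic R P)).
congr (invMean_fun l _); apply: linfty_eq => x /=.
by rewrite !indicE opprK; congr (_%:R); congr nat_of_bool; apply/idP/idP; rewrite !inE.
Qed.

(** Translation invariance of the mean gives invariance on cylinders, which form
   a generating family closed under intersection. *)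
Lemma shift_measure_invariant g (E : set X) : measurable E ->
  mu (shift g @` E) = mu E.
Proof.
move=> mE; rewrite image_shiftE.
pose nu := pushforward mu (shift (- g) : X -> X).
have : nu E = mu E; last by [].
apply: (@measure_unique _ _ X (@measurable _ (config G)) (fun=> setT)) => //.
- by move=> C D; exact: measurableI.
- by rewrite bigcup_const.
- exact: measurable_shift.
- move=> mf C cC; change (shift_measure l B (shift (- g) @^-1` C) = shift_measure l B C).
  rewrite shift_measureE; last exact: cylinder_shift.
  by rewrite shift_measureE // /premeasure preimage_itinerary_shift meas_shift.
- by move=> mf _; change (shift_measure l B setT < +oo)%E; rewrite shift_measure_setT ltry.
Qed.

Lemma shift_dense (E : set X) : measurable E -> forall e : R, 0 < e ->
  exists2 D, cylinder D & rmu mu (symdiff E D) < e.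
Proof.
move=> mE e e0; apply: (@measure_algebra_dense _ _ X mu (@cylinder G)) => //.
- exact: cylinder0.
- exact: cylinderU.
- exact: cylinderC.
Qed.

Lemma shift_Gspace : is_Gspace mu (@shift G : G -> X -> X).
Proof.
split.
- have [C [cC Csurj]] := cylinder_enumeration.
  apply: (@separable_L2_of_dense _ _ _ mu C) => [n|E mE e e0].
    exact: measurable_cylinder.
  by have [D /Csurj[n <-] ED] := shift_dense mE e0; exists n.
- exact: shift0.
- exact: shiftD.
- exact: measurable_shift.
- exact: shift_measure_invariant.
Qed.

Lemma rmu_cylinder (C : set (config G)) : cylinder C ->
  rmu mu C = meas l (itinerary B @^-1` C).
Proof. by move=> cC; rewrite -[RHS]/(fine (premeasure l B C)) -shift_measureE. Qed.

End ShiftSystem.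

(** * Conditioning a mean on an invariant set of configurations *)

Section Conditioning.
Context {R : realType} {G : zmodType} (hG : countable [set: G]).
Variables (l : @invMean R G) (B : set G).
Local Notation L := (linfty G R).
Local Notation X := (g_sigma_algebraType (@measurable _ (config G))).
Local Notation mu := (shift_measure l B).
Local Notation it := (itinerary B).
Implicit Types (P Q : set G) (f g : L).

Fact restrict_bounded P f : (fun x => \1_P x * f x) \in @bounded_pred G R.
Proof.
have [M fM] := linfty_fun_bounded f; apply/bounded_predP; exists M => x.
by apply: le_trans (fM x); rewrite normrM ler_piMl // indicE; case: (_ \in _);
  rewrite ?normr1 ?normr0.
Qed.

Definition restrict P f : L := Linfty (restrict_bounded P f).

Lemma invMean_le_meas P f (M : R) : (forall x, `|f x| <= M * \1_P x) ->
  `|l f| <= M * meas l P.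
Proof.
move=> fM; have lP := invMeanP l.
rewrite ler_norml -mulNr /meas -!(invmeanZ lP).
have fMx x : - M * \1_P x <= f x <= M * \1_P x by rewrite mulNr -ler_norml.
by apply/andP; split; apply: (le_invmean lP) => x; have /andP[] := fMx x.
Qed.

Lemma restrict_norm_le P f (M : R) : (forall x, `|f x| <= M) ->
  `|l (restrict P f)| <= M * meas l P.
Proof.
move=> fM; apply: invMean_le_meas => x /=; rewrite normrM mulrC indicE.
by rewrite (ger0_norm (ler0n _ _)) ler_wpM2r ?ler0n.
Qed.

Lemma restrict_comb P a f g :
  restrict P (a *: f + g) = a *: restrict P f + restrict P g.
Proof.
apply: linfty_eq => x.
change (\1_P x * (a * f x + g x) = a * (\1_P x * f x) + \1_P x * g x); ring.
Qed.

Lemma restrict_indic P Q : restrict P (linfty_indic R Q) = linfty_indic R (P `&` Q).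
Proof. by apply: linfty_eq => x /=; rewrite indicI. Qed.

Lemma restrict_translate P a f :
  l (restrict P (translate a f)) = l (restrict [set x | P (x + a)] f).
Proof.
rewrite -(invmean_translate (invMeanP l) (- a) (restrict P _)).
congr (invMean_fun l _); apply: linfty_eq => x /=; rewrite opprK addrK.
by rewrite !indicE; congr (_%:R * _); congr nat_of_bool; apply/idP/idP; rewrite !inE.
Qed.

Lemma dist_restrict_le P Q f (M : R) : (forall x, `|f x| <= M) ->
  `|l (restrict P f) - l (restrict Q f)| <= M * meas l (symdiff P Q).
Proof.
move=> fM; rewrite -(invmeanB (invMeanP l)); apply: invMean_le_meas => x.
have -> : (restrict P f - restrict Q f) x = (\1_P x - \1_Q x) * f x.
  by rewrite mulrBl.
have M0 : 0 <= M by apply: le_trans (fM x).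
rewrite normrM mulrC !indicE in_setU !in_setD.
by case: (x \in P); case: (x \in Q);
  rewrite /= ?subrr ?subr0 ?sub0r ?normrN ?normr0 ?normr1 ?mulr0 ?mulr1.
Qed.

Variables (E : set X) (C : nat -> set (config G)).
Hypothesis mE : measurable E.
Hypothesis Einv : forall a : G, shift a @` E = E.
Hypothesis Ccyl : forall n, cylinder (C n).
Hypothesis EC : forall n, rmu mu (symdiff E (C n)) < n.+1%:R^-1.
Local Notation p := (rmu mu E).
Hypothesis p0 : 0 < p.

(** The set E of configurations need not come from a subset of G, but cylinders
   C n close to E do; conditioning on their preimages, in the limit, conditions
   the mean on E. *)
Definition conditional f : R := ulim (fun n => l (restrict (it @^-1` C n) f)) / p.

Let mC n : measurable (C n : set X). Proof. exact: measurable_cylinder. Qed.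

Lemma cvg_of_dist (u : nat -> R) (a c : R) :
  (forall n, `|a - u n| <= c * n.+1%:R^-1) -> u @ \oo --> a.
Proof.
move=> uc; apply/cvgrPdist_le => e e0.
have c0 : (fun n : nat => c * n.+1%:R^-1) @ \oo --> (0 : R).
  by rewrite -(mulr0 c); apply: cvgMr; exact: cvg_harmonic.
have : \forall n \near \oo, c * n.+1%:R^-1 < e by exact: (cvgr_lt _ c0).
by apply: filterS => n /ltW; apply: le_trans.
Qed.

Lemma meas_restrict_cvg D : cylinder D ->
  (fun n => meas l (it @^-1` C n `&` it @^-1` D)) @ \oo --> rmu mu (E `&` D).
Proof.
move=> cD; apply: (@cvg_of_dist _ _ 1) => n; rewrite mul1r.
have mD : measurable (D : set X) by exact: measurable_cylinder.
rewrite -preimage_setI -(@rmu_cylinder R); last first.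
  by apply: (@measurableI _ (config G)) => //; exact: Ccyl.
apply: le_trans (ltW (EC n)); apply: le_trans (dist_rmu_le _ _ _) _.
- exact: measurableI.
- exact: measurableI.
apply: le_rmu; [|exact: measurable_symdiff|exact: symdiffI_sub].
by apply: measurable_symdiff; exact: measurableI.
Qed.

Lemma conditional_cylinder D : cylinder D ->
  conditional (linfty_indic R (it @^-1` D)) = rmu mu (E `&` D) / p.
Proof.
move=> cD; congr (_ / _); apply: ulim_lim.
under eq_fun do rewrite restrict_indic.
exact: meas_restrict_cvg.
Qed.

Let restrict_ubnd f : exists M, forall n, `|l (restrict (it @^-1` C n) f)| <= M.
Proof.
have [M fM] := linfty_fun_bounded f; exists M => n.
have M0 : 0 <= M by apply: le_trans (fM 0).
apply: le_trans (restrict_norm_le _ fM) _; rewrite ler_piMr //.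
by rewrite -(measT l) le_meas.
Qed.

Lemma symdiff_shift_le a n :
  rmu mu (symdiff (shift a @^-1` C n) (C n)) <= 2 * n.+1%:R^-1.
Proof.
have cS : cylinder (shift a @^-1` C n) by exact: cylinder_shift.
have mS : measurable (shift a @^-1` C n : set X) by exact: measurable_cylinder.
apply: le_trans (@le_symdiff_trans _ _ X mu E _ _ mE mS (mC n)) _.
rewrite mulr2n mulrDl mul1r lerD //; last exact: ltW.
have -> : rmu mu (symdiff (shift a @^-1` C n) E) = rmu mu (symdiff E (C n)).
  rewrite -(rmu_act (shift_Gspace hG l B) (- a) (measurable_symdiff mE (mC n))).
  have Ea : shift a @^-1` E = E by rewrite -[RHS](Einv (- a)) image_shiftE opprK.
  by rewrite image_shiftE opprK symdiffC -[in LHS]Ea.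
exact: ltW.
Qed.

(** Translating f by a in the average over C n amounts to replacing C n by a
   translate.  As E is invariant, the translate is as close to E as C n is, hence
   close to C n, and the limit does not change. *)
Theorem conditional_invmean : invmean conditional.
Proof.
have lP := invMeanP l; split.
- move=> a f g; rewrite /conditional mulrA -mulrDl; congr (_ / _).
  have [M fM] := restrict_ubnd f; have [N gN] := restrict_ubnd g.
  have := ulim_comb a 1 fM gN; rewrite mul1r => <-; congr ulim.
  by apply: funext => n; rewrite restrict_comb (invmean_linear lP) mul1r.
- move=> f f0; rewrite divr_ge0 ?rmu_ge0 //.
  have [M fM] := restrict_ubnd f.
  have c : (fun n => l (restrict (it @^-1` C n) f)) @ natU -->
      ulim (fun n => l (restrict (it @^-1` C n) f)).
    by apply: (@cvg_ulim _ _ M); exact: nearW.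
  apply: (cvgr_to_ge c); apply: nearW => n; apply: (invmean_ge0 lP) => x /=.
  by rewrite mulr_ge0 // indicE ler0n.
- rewrite -(preimage_setT it) conditional_cylinder; last exact: (@measurableT _ (config G)).
  by rewrite setIT divff // gt_eqF.
- move=> a f; congr (_ / _).
  have [M fM] := restrict_ubnd f.
  have c : (fun n => l (restrict (it @^-1` C n) f)) @ natU -->
      ulim (fun n => l (restrict (it @^-1` C n) f)).
    by apply: (@cvg_ulim _ _ M); exact: nearW.
  apply: ulim_cvg; rewrite -[X in _ --> X]addr0.
  have -> : (fun n => l (restrict (it @^-1` C n) (translate a f))) =
    (fun n => l (restrict (it @^-1` C n) f)) \+
    (fun n => l (restrict (it @^-1` C n) (translate a f)) - l (restrict (it @^-1` C n) f)).
    by apply: funext => n /=; rewrite addrC subrK.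
  apply: cvgD => //; apply: cvg_eventually_natU.
  have [N fN] := linfty_fun_bounded f.
  have N0 : 0 <= N by apply: le_trans (fN 0).
  apply: (@cvg_of_dist _ _ (N * 2)) => n; rewrite sub0r normrN restrict_translate.
  apply: le_trans (dist_restrict_le _ _ fN) _; rewrite -mulrA ler_wpM2l //.
  apply: le_trans (symdiff_shift_le a n).
  rewrite -preimage_itinerary_shift.
  rewrite -[X in meas l X]/(it @^-1` symdiff (shift a @^-1` C n) (C n)).
  rewrite rmu_cylinder //; have cS := cylinder_shift a (Ccyl n).
  apply: (@measurableU _ (config G)); apply: (@measurableD _ (config G)) => //;
    exact: Ccyl.
Qed.

End Conditioning.

(** * Ergodic means and the density inequalities *)

Section ErgodicMeans.
Context {R : realType} {G : zmodType} (hG : countable [set: G]).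
Local Notation L := (linfty G R).
Local Notation X := (g_sigma_algebraType (@measurable _ (config G))).
Implicit Types (A B : set G).
Local Notation sset := (@actset G _ X (@shift G)).

Lemma near_idempotent_absurd (p z u v : R) : 0 < p -> p < 1 ->
  u < (p - p ^+ 2) / 4 -> v <= u -> `|p - p * z| <= v -> `|p - z| <= u -> False.
Proof. by rewrite !ler_norml => p0 p1 up vu /andP[? ?] /andP[? ?]; nra. Qed.

(** Choose the mean to be a lexicographic maximiser of its value at f0 followed by
   its values on all cylinders.  If E were invariant with 0 < mu(E) < 1, the mean
   would be a convex combination of its conditionings on E and on the complement
   of E, which would then agree with it on all cylinders.  This says that E is
   independent of every cylinder, hence of itself, so mu(E) = mu(E)^2. *)
Theorem ergodic_maximising_mean B (f0 : L) : (@invmean R G) !=set0 ->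
  exists l : @invMean R G, (forall psi, invmean psi -> psi f0 <= l f0) /\
    ergodic (shift_measure l B) (@shift G : G -> X -> X).
Proof.
move=> inv0; have [C [cC Csurj]] := cylinder_enumeration hG.
pose h j := if j is j'.+1
  then fun phi : L -> R => phi (linfty_indic R (itinerary B @^-1` C j'))
  else fun phi : L -> R => phi f0.
have hcont j : ucontinuous (@invmean R G) (h j).
  by case: j => [|j]; exact: invmean_coord.
have [phi [phim phimax phiext]] := lex_maximiser inv0 (@invmean_uclosed R G) hcont.
pose l := InvMean phim; exists l; split => // -[E [mE Einv E01]].
set mu := shift_measure l B in E01 *; pose p := rmu mu E.
have [p0 p1] : 0 < p /\ p < 1.
  by move: E01; rewrite (@rmuE _ _ _ mu) // !lte_fin => /andP.
have /choice[D DP] : forall n : nat, exists D,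
    cylinder D /\ rmu mu (symdiff E D) < n.+1%:R^-1.
  move=> n; have [|D cD ED] := @shift_dense R G l B E mE n.+1%:R^-1; last by exists D.
  by rewrite invr_gt0.
have cD n : cylinder (D n) by have [] := DP n.
have ED n : rmu mu (symdiff E (D n)) < n.+1%:R^-1 by have [] := DP n.
have mE' : measurable (~` E) by exact: measurableC.
have E'inv a : shift a @` (~` E) = ~` E.
  rewrite image_shiftE preimage_setC; congr (~` _).
  by rewrite -[RHS](Einv a) image_shiftE.
have cD' n : cylinder (~` D n) by exact: cylinderC.
have E'D n : rmu mu (symdiff (~` E) (~` D n)) < n.+1%:R^-1 by rewrite symdiff_setC.
have p'E : rmu mu (~` E) = 1 - p.
  by rewrite -setTD rmuD_sub // rmu_setT.
have p'0 : 0 < rmu mu (~` E) by rewrite p'E subr_gt0.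
have psi1m := conditional_invmean hG mE Einv cD ED p0.
have psi2m := conditional_invmean hG mE' E'inv cD' E'D p'0.
have split_l f : l f = p * conditional l B E D f +
    (1 - p) * conditional l B (~` E) (fun n => ~` D n) f.
  rewrite -p'E /conditional mulrCA divff ?gt_eqF // mulr1.
  rewrite [_ * (_ / _)]mulrCA divff ?gt_eqF // mulr1.
  have [M fM] := linfty_fun_bounded f.
  have M0 : 0 <= M by apply: le_trans (fM 0).
  have bnd (P : nat -> set G) n : `|l (restrict (P n) f)| <= M.
    apply: le_trans (restrict_norm_le _ _ fM) _; rewrite ler_piMr //.
    by rewrite -(measT l) le_meas.
  have := ulim_comb 1 1 (bnd (fun n => itinerary B @^-1` D n))
    (bnd (fun n => itinerary B @^-1` (~` D n))).
  rewrite !mul1r => <-; rewrite -[LHS]ulim_cst; congr ulim; apply: funext => n.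
  rewrite !mul1r -(invmeanD (invMeanP l)); congr (invMean_fun l _).
  apply: linfty_eq => x.
  change (f x = \1_(itinerary B @^-1` D n) x * f x +
    \1_(itinerary B @^-1` (~` D n)) x * f x).
  rewrite -mulrDl preimage_setC indicC indicE.
  by case: (x \in _); rewrite ?addr0 ?add0r mul1r.
have p01 : 0 < p < 1 by rewrite p0.
(* Coordinate n.+1 of the lexicographic order is the value on the n-th cylinder. *)
have indep Z : cylinder Z -> rmu mu (E `&` Z) = p * rmu mu Z.
  move=> cZ; have [n nZ] := Csurj _ cZ.
  have hcomb j : h j phi = p * h j (conditional l B E D) +
      (1 - p) * h j (conditional l B (~` E) (fun n => ~` D n)).
    by case: j => [|j]; exact: split_l.
  have := phiext p _ _ p01 psi1m psi2m hcomb n.+1; rewrite /h nZ.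
  rewrite (@conditional_cylinder R G l B E D) // -/p.
  move=> /(congr1 (fun t => t * p)); rewrite divfK ?gt_eqF // => ->.
  by rewrite (rmu_cylinder l B cZ) mulrC.
have p2 : 0 < (p - p ^+ 2) / 4 by rewrite divr_gt0 // subr_gt0 expr2 gtr_pMr.
have [|Z cZ EZ] := @shift_dense R G l B E mE ((p - p ^+ 2) / 4); first by [].
have mZ : measurable (Z : set X) by exact: measurable_cylinder.
have mEZ : measurable (E `&` Z) by exact: measurableI.
have := dist_rmu_le mu mE mZ; have := dist_rmu_le mu mE mEZ.
have : rmu mu (symdiff E (E `&` Z)) <= rmu mu (symdiff E Z).
  apply: le_rmu; [exact: measurable_symdiff|exact: measurable_symdiff|].
  move=> x [[Ex n]|[[Ex _] []//]]; left; split => // Zx; exact: n.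
rewrite (indep Z cZ) -/p => vu vp up.
exact: (near_idempotent_absurd p0 p1 EZ vu vp up).
Qed.

(** The Pluennecke inequality transfers to the mean because B is the preimage of
   the cylinder B' of configurations with a 1 at the origin, while F B' has
   preimage F + B for each finite F contained in A. *)
Lemma ergodic_mean_pluennecke (l : @invMean R G) A B (k : nat) :
  (0 < k)%N -> ergodic_basis R k A ->
  ergodic (shift_measure l B) (@shift G : G -> X -> X) -> 0 < meas l B ->
  meas l B ^+ k.-1 <= meas l (sumset A B) ^+ k.
Proof.
move=> k0 Abasis lerg B0; set mu := shift_measure l B.
have Gs : is_Gspace mu (@shift G : G -> X -> X) := shift_Gspace hG l B.
pose B' : set (config G) := [set y | y 0].
have cB' : cylinder B'.
  by exists [:: 0] => y z yz; rewrite /B' /= yz // mem_head.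
have B'E : rmu mu B' = meas l B.
  rewrite rmu_cylinder //; congr meas; apply/seteqP; split => x;
    by rewrite /B' /itinerary /= subr0 => /asboolP.
have mB' : measurable (B' : set X) by exact: measurable_cylinder.
have AB : rmu mu (sset A B') <= meas l (sumset A B).
  have [s [sA cs]] := actset_exhaustion hG Gs A.
  apply: (cvgr_to_le (cs B' mB')); apply: nearW => n.
  have cyl_act (t : seq G) : cylinder (sset [set` t] B').
    elim: t => [|a t IH]; first by rewrite /actset set_nil bigcup_set0; exact: cylinder0.
    rewrite actset_cons; apply: cylinderU => //.
    have : cylinder (shift a @` B') by rewrite image_shiftE; exact: cylinder_shift.
    exact.
  rewrite rmu_cylinder //; apply: le_meas => x [a /= /sA Aa [y By yx]].
  have /asboolP Bx : itinerary B x a by rewrite -yx /shift subrr.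
  by exists a => //; exists (x - a) => //; rewrite addrC subrK.
rewrite -B'E; rewrite -B'E in B0.
apply: (@le_trans _ _ (rmu mu (sset A B') ^+ k)).
  apply: (measure_pluennecke hG Gs k0 mB' B0) => E mE E0.
  have := Abasis _ _ mu (@shift G) Gs lerg E mE.
  by rewrite /rmu => ->//; rewrite (@rmuE _ _ _ mu) // lte_fin.
by apply: lerXn2r => //; rewrite nnegrE ?rmu_ge0 ?meas_ge0.
Qed.

Lemma powRz_le_of_exp (a b : R) (k : nat) : (0 < k)%N -> 0 <= a -> 0 <= b ->
  (0 < a -> a ^+ k.-1 <= b ^+ k) -> powRz a (1 - k%:R^-1) <= b.
Proof.
move=> k0 a0 b0 ab; rewrite /powRz; have [//|an0] := eqVneq a 0.
have a_gt0 : 0 < a by rewrite lt_neqAle eq_sym an0.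
rewrite -(@ler_pXn2r _ k) // ?nnegrE ?powR_ge0 //.
rewrite -powR_mulrn ?powR_ge0 // -powRrM mulrBl mul1r mulVf ?pnatr_eq0 -?lt0n //.
rewrite -{1}(prednK k0) -[k.-1.+1%:R]natr1 addrK powR_mulrn //.
exact: ab.
Qed.

(** Both densities are attained at ergodic means: for the upper one the mean
   maximises the measure of B, for the lower one it minimises the measure of
   A + B.  Without invariant means all four densities are 0. *)
Theorem ergodic_basis_density A B (k : nat) :
  (0 < k)%N -> ergodic_basis R k A ->
  upper_density R (sumset A B) >= powRz (upper_density R B) (1 - k%:R^-1) /\
  lower_density R (sumset A B) >= powRz (lower_density R B) (1 - k%:R^-1).
Proof.
move=> k0 Abasis.
have [inv0|noinv] := pselect ((@invmean R G) !=set0); last first.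
  have V0 Z : [set meas phi Z | phi in @invmean R G] = set0.
    by apply/seteqP; split => // t [phi phim _]; apply: noinv; exists phi.
  rewrite !upper_densityE !lower_densityE !V0 sup0 inf0.
  by rewrite /powRz eqxx.
have kV : 0 <= 1 - k%:R^-1 :> R by rewrite subr_ge0 invf_le1 ?ltr0n // ler1n.
pose V Z := [set meas phi Z | phi in @invmean R G].
have V0 Z : V Z !=set0 by have [phi phim] := inv0; exists (meas phi Z), phi.
have V_ge0 Z : lbound (V Z) 0 by move=> _ [phi phim <-]; exact: (meas_ge0 (InvMean phim)).
have V_le1 Z : ubound (V Z) 1.
  move=> _ [phi phim <-]; rewrite -(measT (InvMean phim)).
  exact: (le_meas (InvMean phim)).
have V_mem (l : invMean) Z : V Z (meas l Z) by exists l => //; exact: invMeanP.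
have le_sup (l : invMean) Z : meas l Z <= sup (V Z).
  by apply: ub_le_sup => //; exists 1.
have inf_le (l : invMean) Z : inf (V Z) <= meas l Z.
  by apply: ge_inf => //; exists 0.
rewrite !upper_densityE !lower_densityE -!/(V _); split.
  have [l [lmax lerg]] := ergodic_maximising_mean B (linfty_indic R B) inv0.
  have lB : sup (V B) = meas l B.
    apply/eqP; rewrite eq_le le_sup andbT; apply: ge_sup => // _ [psi psim <-].
    exact: lmax.
  apply: le_trans (le_sup l _); rewrite lB.
  apply: powRz_le_of_exp => //; [exact: meas_ge0|exact: meas_ge0|].
  exact: ergodic_mean_pluennecke.
have [l [lmin lerg]] := ergodic_maximising_mean B (- linfty_indic R (sumset A B)) inv0.
have lAB : inf (V (sumset A B)) = meas l (sumset A B).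
  apply/eqP; rewrite eq_le inf_le /=; apply: lb_le_inf => // _ [psi psim <-].
  have := lmin _ psim.
  by rewrite (invmeanN psim) (invmeanN (invMeanP l)) lerN2.
rewrite lAB; apply: powRz_le_of_exp => //.
- exact: lb_le_inf.
- exact: meas_ge0.
move=> v0; apply: le_trans (ergodic_mean_pluennecke k0 Abasis lerg _).
  by apply: lerXn2r (inf_le _ _); rewrite nnegrE ?meas_ge0 // ltW.
exact: lt_le_trans (inf_le _ _).
Qed.

End ErgodicMeans.

(** * Simons's inequality *)

Section Simons.
Context {R : realType} {T : Type}.
Variables (K S : set T) (V : set (T -> R)) (f : nat -> T -> R) (M : R).
Hypothesis fV : forall n, V (f n).
Hypothesis V_comb : forall a b u v, V u -> V v -> V (fun x => a * u x + b * v x).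
Hypothesis V_unif : forall (u : nat -> T -> R) v, (forall n, V (u n)) ->
  (forall n x, K x -> `|v x - u n x| <= 2^-1 ^+ n * M) -> V v.
(* V is a space of functionals on K that attain their maximum on S. *)
Hypothesis V_max : forall u, V u ->
  exists s, [/\ S s, K s & forall x, K x -> u x <= u s].
Hypothesis f_ge0 : forall n x, K x -> 0 <= f n x.
Hypothesis f_leM : forall n x, K x -> f n x <= M.
Hypothesis f_cvg : forall s, S s -> f ^~ s @ \oo --> 0.

(** Convex combinations of the f k with k >= n.  The induction principle proves
   any convex property of a hull element from the same property of the f k. *)
Inductive hull (n : nat) : (T -> R) -> Prop :=
| hull_base k : (n <= k)%N -> hull n (f k)
| hull_comb t g h : 0 <= t <= 1 -> hull n g -> hull n h ->
    hull n (fun x => t * g x + (1 - t) * h x).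

Lemma hull_V n g : hull n g -> V g.
Proof. by elim=> [k _|t g' h' _ _ + _ +]; [exact: fV|exact: V_comb]. Qed.

Lemma hull_ind_le n g x c : hull n g -> (forall k, (n <= k)%N -> f k x <= c) ->
  g x <= c.
Proof.
move=> hg fc; elim: hg => [k /fc//|t g' h' /andP[t0 t1] _ IHg _ IHh]; nra.
Qed.

Lemma hull_ind_ge n g x c : hull n g -> (forall k, (n <= k)%N -> c <= f k x) ->
  c <= g x.
Proof.
move=> hg fc; elim: hg => [k /fc//|t g' h' /andP[t0 t1] _ IHg _ IHh]; nra.
Qed.

Lemma hull_sub m n g : (m <= n)%N -> hull n g -> hull m g.
Proof.
move=> mn; elim=> [k nk|t g' h' t01 _ IHg _ IHh]; last exact: hull_comb.
by apply: hull_base; exact: leq_trans nk.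
Qed.

Lemma hull_bounds n g x : hull n g -> K x -> 0 <= g x <= M.
Proof.
by move=> hg Kx; apply/andP; split;
  [apply: hull_ind_ge hg _ => k _; exact: f_ge0|
   apply: hull_ind_le hg _ => k _; exact: f_leM].
Qed.

Variables (x0 : T) (eps : R).
Hypothesis Kx0 : K x0.
Hypothesis eps0 : 0 < eps.
Hypothesis f_eps : forall n, eps <= f n x0.

Let r (n : nat) : R := 2^-1 ^+ n.

Let r0 n : 0 < r n. Proof. by rewrite exprn_gt0. Qed.
Let rS n : r n = r n.+1 + r n.+1. Proof. by rewrite /r exprS; lra. Qed.
Let r_cvg : r @ \oo --> 0.
Proof. by apply: cvg_expr; rewrite ger0_norm // invf_lt1 // ltr1n. Qed.

Definition supK (u : T -> R) : R := sup [set u x | x in K].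

Lemma near_minimiser n (u : T -> R) (c e : R) :
  (forall x, K x -> `|u x| <= c) -> 0 < e ->
  exists2 g, hull n g & forall h, hull n h ->
    supK (fun x => u x + r n * g x) <= supK (fun x => u x + r n * h x) + e.
Proof.
move=> uc e0.
pose P := [set supK (fun x => u x + r n * g x) | g in hull n].
have le_supK g x : hull n g -> K x ->
    u x + r n * g x <= supK (fun x => u x + r n * g x).
  move=> hg Kx; apply: ub_le_sup; last by exists x.
  exists (c + r n * M) => _ [y Ky <-]; have /andP[_ gM] := hull_bounds hg Ky.
  by rewrite lerD ?ler_wpM2l ?(ltW (r0 n)) // (le_trans (ler_norm _)) // uc.
have hiP : has_inf P.
  split; first by exists (supK (fun x => u x + r n * f n x)), (f n) => //; exact: hull_base.
  exists (u x0) => _ [g hg <-]; apply: le_trans (le_supK _ _ hg Kx0).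
  have /andP[g0 _] := hull_bounds hg Kx0.
  by rewrite lerDl mulr_ge0 // ltW.
have [_ [g hg <-] gP] := inf_adherent e0 hiP.
exists g => // h hh; apply: le_trans (ltW gP) _; rewrite lerD2r.
by apply: ge_inf; [exact: hiP.2|exists h].
Qed.

(** Simons's inequality, specialised to functions that are nonnegative and tend to
   0 on the boundary S: they cannot all be at least eps at one point x0 of K.
   Let G be the sum over n of 2^-(n+1) g n, where g n in the hull of the tail
   f n, f (n+1), ... nearly minimises the supremum over K of G_n + 2^-n g, and
   G_n is the n-th partial sum.  Let s in S maximise G, with a = G s >= eps.
   Replacing the remaining terms of G by g n raises the supremum by a tiny amount
   only, so G_n s + 2^-n g n s <= a + tiny; by induction G_n s is hardly larger
   than (1 - 2^-n) a.  So the tails of G at s keep their share 2^-n a of the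
   total, which is impossible if f n s tends to 0. *)
Theorem simons_absurd : False.
Proof.
have M0 : 0 <= M by apply: le_trans (f_leM 0 Kx0); exact: f_ge0.
have /choice[g gP] : forall nu : nat * (T -> R), exists g, hull nu.1 g /\
    forall c, (forall x, K x -> `|nu.2 x| <= c) -> forall h, hull nu.1 h ->
      supK (fun x => nu.2 x + r nu.1 * g x) <=
      supK (fun x => nu.2 x + r nu.1 * h x) + eps / 4 * (r nu.1 * r nu.1).
  move=> [n u] /=; have [[c uc]|nc] := pselect (exists c, forall x, K x -> `|u x| <= c).
    have [|g hg gmin] := @near_minimiser n u c (eps / 4 * (r n * r n)) uc.
      by rewrite !mulr_gt0.
    by exists g; split => // _ _ h hh; exact: gmin.
  exists (f n); split; first exact: hull_base.
  by move=> c uc; exfalso; apply: nc; exists c.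
pose H := fix H n := if n is n'.+1
  then (fun x => H n' x + r n * g (n', H n') x) else (fun=> 0).
pose gs n := g (n, H n).
have HS n x : H n.+1 x = H n x + r n.+1 * gs n x by [].
have hgs n : hull n (gs n) by have [] := gP (n, H n).
have gsM n x : K x -> 0 <= gs n x <= M by move=> Kx; exact: hull_bounds (hgs n) Kx.
have H_bnd n m x : K x -> H n x <= H (n + m)%N x <= H n x + (r n - r (n + m)%N) * M.
  move=> Kx; elim: m => [|m]; first by rewrite addn0 subrr mul0r addr0 lexx.
  move=> /andP[h1 h2]; rewrite addnS HS; have /andP[g0 gM] := gsM (n + m)%N x Kx.
  have r1 := r0 (n + m).+1; have r2 := rS (n + m)%N.
  by apply/andP; split; nra.
pose Hoo x := sup [set H n x | n in setT].
have Hoo_bnd n x : K x -> H n x <= Hoo x <= H n x + r n * M.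
  move=> Kx; have ubH : ubound [set H n x | n in setT] (H n x + r n * M).
    move=> _ [m _ <-]; have [nm|/ltnW mn] := leqP n m.
      have /andP[_] := H_bnd n (m - n)%N x Kx; rewrite subnKC // => h.
      by apply: le_trans h _; rewrite lerD2l ler_wpM2r // gerBl ltW.
    have /andP[+ _] := H_bnd m (n - m)%N x Kx; rewrite subnKC // => h.
    by apply: le_trans h _; rewrite lerDl mulr_ge0 // ltW.
  apply/andP; split; first by apply: ub_le_sup; [exists (H n x + r n * M)|exists n].
  by apply: ge_sup => //; exists (H n x), n.
have VH n : V (H n.+1).
  elim: n => [|n IH].
    have := V_comb (r 1) 0 (hull_V (hgs 0%N)) (hull_V (hgs 0%N)).
    by congr V; apply: funext => x; rewrite HS /= mul0r addr0 add0r.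
  have := V_comb 1 (r n.+2) IH (hull_V (hgs n.+1)).
  by congr V; apply: funext => x; rewrite HS mul1r.
have VHoo : V Hoo.
  apply: (V_unif VH) => n x Kx; have /andP[h1 h2] := Hoo_bnd n.+1 x Kx.
  rewrite ger0_norm ?subr_ge0 // lerBlDl; apply: le_trans h2 _.
  by rewrite lerD2l -/(r n) ler_wpM2r // (rS n) lerDl ltW.
have [s [Ss Ks smax]] := V_max VHoo; pose a := Hoo s.
have tail_hull m n h : hull (n + m)%N h -> exists2 h', hull n h' &
    forall x, H (n + m)%N x + r (n + m)%N * h x = H n x + r n * h' x.
  elim: m h => [|m IH] h; first by rewrite addn0; exists h.
  rewrite addnS => hh; have hh' : hull (n + m)%N h by exact: hull_sub hh.
  have h2 : 0 <= (2^-1 : R) <= 1 by rewrite invr_ge0 ler0n invf_le1 // ler1n.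
  have [h' hh'' E] := IH _ (hull_comb h2 (hgs (n + m)%N) hh').
  exists h' => // x; rewrite -E HS (rS (n + m)%N); lra.
have Ha n : H n s + r n * gs n s <= a + eps / 4 * (r n * r n).
  have bH x : K x -> `|H n x| <= M.
    move=> Kx; have := H_bnd 0%N n x Kx; rewrite add0n /= add0r => /andP[h1 h2].
    rewrite ger0_norm //; apply: le_trans h2 _.
    by rewrite ler_piMl // /r expr0 gerBl ltW // r0.
  have [_ /(_ M bH)] := gP (n, H n); rewrite /= -/(gs n) => min.
  apply: (@le_trans _ _ (supK (fun x => H n x + r n * gs n x))).
    apply: ub_le_sup; last by exists s.
    exists (M + r n * M) => _ [x Kx <-]; have /andP[_ gM] := gsM n x Kx.
    by rewrite lerD ?ler_wpM2l ?(ltW (r0 n)) // (le_trans (ler_norm _)) // bH.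
  suff le_a m : supK (fun x => H n x + r n * gs n x) <=
      a + r (n + m)%N * M + eps / 4 * (r n * r n).
    have c : (fun m => a + r (m + n)%N * M + eps / 4 * (r n * r n)) @ \oo -->
        a + 0 * M + eps / 4 * (r n * r n).
      apply: cvgD; last exact: cvg_cst.
      apply: cvgD; first exact: cvg_cst.
      by apply: cvgMl; apply: (cvg_comp _ _ _ r_cvg); exact: cvg_addnr.
    rewrite mul0r addr0 in c; apply: (cvgr_to_ge c); apply: nearW => m.
    by rewrite addnC; exact: le_a.
  have [h hh E] := tail_hull m n _ (hgs (n + m)%N).
  apply: le_trans (min _ hh) _; rewrite lerD2r.
  apply: ge_sup; first by exists (H n x0 + r n * h x0), x0.
  move=> _ [x Kx <-]; rewrite -E; apply: lerD.
    apply: le_trans (smax _ Kx).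
    by have /andP[] := Hoo_bnd (n + m)%N x Kx.
  by rewrite ler_wpM2l ?(ltW (r0 _)) //; have /andP[] := gsM (n + m)%N x Kx.
(* The tolerance (eps / 4) 4^-n was chosen so that the accumulated errors stay
   below 2^-n eps / 2. *)
have Hn n : H n s <= (1 - r n) * a + r n * (eps / 2 * (1 - r n)).
  elim: n => [|n IH]; first by rewrite /= /r expr0 subrr mul0r mul1r mulr0 addr0.
  have := Ha n; have := r0 n.+1; rewrite HS; have := rS n.
  by move: (r n) (r n.+1) (H n s) (gs n s) IH => x y z w IH xy y0; rewrite xy in IH *; lra.
have aeps : eps <= a.
  have Hx0 n : (1 - r n) * eps <= H n x0.
    elim: n => [|n IH]; first by rewrite /= /r expr0 subrr mul0r.
    have : eps <= gs n x0 by apply: hull_ind_ge (hgs n) _ => k _; exact: f_eps.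
    by have := rS n; have := r0 n.+1; rewrite HS; nra.
  have c : (fun n => (1 - r n) * eps) @ \oo --> (1 - 0) * eps.
    by apply: cvgMl; apply: cvgB => //; exact: cvg_cst.
  rewrite subr0 mul1r in c; apply: (cvgr_to_le c); apply: nearW => n.
  apply: le_trans (Hx0 n) _; apply: le_trans (smax _ Kx0).
  by have /andP[] := Hoo_bnd n x0 Kx0.
have [N fN] : exists N, forall k, (N <= k)%N -> f k s <= eps / 4.
  have : \forall k \near \oo, f k s < eps / 4.
    by apply: (cvgr_lt _ (f_cvg Ss)); rewrite divr_gt0.
  by move=> [N _ fN]; exists N => k /fN /ltW.
have tailN m : H (N + m)%N s <= H N s + (r N - r (N + m)%N) * (eps / 4).
  elim: m => [|m IH]; first by rewrite addn0 subrr mul0r addr0.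
  rewrite addnS HS.
  have : gs (N + m)%N s <= eps / 4.
    apply: hull_ind_le (hgs _) _ => k Nk; apply: fN.
    by apply: leq_trans Nk; exact: leq_addr.
  by have := rS (N + m)%N; have := r0 (N + m).+1; nra.
have aN : a <= H N s + r N * (eps / 4).
  apply: ge_sup; first by exists (H 0%N s), 0%N.
  move=> _ [m _ <-]; have /andP[h _] := H_bnd m N s Ks.
  apply: le_trans h _; rewrite addnC; apply: le_trans (tailN m) _.
  by rewrite lerD2l ler_wpM2r ?divr_ge0 ?(ltW eps0) // gerBl ltW.
have rN0 := r0 N; have rae : 0 <= r N * (a - eps).
  by rewrite mulr_ge0 ?subr_ge0 // ltW.
have re : 0 < r N * eps by rewrite mulr_gt0.
have rre : 0 < r N * (r N * eps) by rewrite mulr_gt0.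
by have := Hn N; lra.
Qed.

End Simons.

(** * Positive definite functions *)

Section PositiveDefinite.
Context {R : realType} {G : zmodType}.
Implicit Types (phi psi : G -> R) (s : seq (R * G)) (x y g : G).

Definition quadform phi s : R :=
  \sum_(p <- s) \sum_(q <- s) p.1 * q.1 * phi (p.2 - q.2).

(** The correlations of a set with its translates are real, and in the space of real
   positive definite functions, which are even, the extreme points are the real
   parts of characters. *)
Record posdef phi : Prop := {
  posdef1 : phi 0 = 1 ;
  posdef_even : forall x, phi (- x) = phi x ;
  posdef_ge0 : forall s, 0 <= quadform phi s }.

Lemma quadform_scale a phi s :
  quadform (fun x => a * phi x) s = a * quadform phi s.
Proof.
rewrite /quadform mulr_sumr; apply: eq_bigr => p _.
by rewrite mulr_sumr; apply: eq_bigr => q _; rewrite mulrCA.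
Qed.

Lemma psd_norm_le psi x : (forall y, psi (- y) = psi y) ->
  (forall s, 0 <= quadform psi s) -> `|psi x| <= psi 0.
Proof.
move=> even psd; have := psd [:: (1, 0); (1, x)]; have := psd [:: (1, 0); (-1, x)].
rewrite /quadform !big_cons !big_nil /= !subrr sub0r subr0 even ler_norml.
by move=> ? ?; apply/andP; split; lra.
Qed.

(** Seen as a measure c on G, the sequence on the right is c * (delta_0 + e delta_g);
   expanding its square gives the second difference on the left. *)
Lemma quadform_laplacian phi g (e : R) s : e ^+ 2 = 1 ->
  quadform (fun d => 2 * phi d + e * (phi (d + g) + phi (d - g))) s =
  quadform phi (s ++ [seq (e * p.1, p.2 + g) | p <- s]).
Proof.
move=> e2; rewrite /quadform big_cat /= big_map /= -big_split /=.
apply: eq_bigr => p _; rewrite !big_cat /= !big_map /= -!big_split /=.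
apply: eq_bigr => q _ /=.
have -> : p.2 + g - (q.2 + g) = p.2 - q.2 by rewrite opprD addrACA subrr addr0.
have -> : p.2 - (q.2 + g) = p.2 - q.2 - g by rewrite opprD addrA.
have -> : p.2 + g - q.2 = p.2 - q.2 + g by rewrite addrAC.
rewrite [X in _ = _ + (_ + X * _)](_ : _ = p.1 * q.1); first by ring.
by rewrite mulrACA -expr2 e2 mul1r.
Qed.

Lemma posdef_norm_le phi x : posdef phi -> `|phi x| <= 1.
Proof.
by move=> pd; rewrite -(posdef1 pd); apply: psd_norm_le; [exact: posdef_even|exact: posdef_ge0].
Qed.

Lemma cvg_sum_seq (I : Type) (F : set_system nat) (FF : Filter F) (r : seq I)
    (u : nat -> I -> R) (v : I -> R) : (forall i, u ^~ i @ F --> v i) ->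
  (fun n => \sum_(i <- r) u n i) @ F --> \sum_(i <- r) v i.
Proof.
move=> uv; elim: r => [|i r IH].
  rewrite big_nil; under eq_fun do rewrite big_nil; exact: cvg_cst.
by rewrite big_cons; under eq_fun do rewrite big_cons; apply: cvgD.
Qed.

Lemma posdef_uclosed : uclosed posdef.
Proof.
move=> Phi PhiP.
have cv x : (fun n => Phi n x) @ natU --> plim Phi x.
  apply: (@cvg_ulim _ _ 1); apply: filterS PhiP => n; exact: posdef_norm_le.
split.
- apply: (ulim_near_cvg _ (cvg_cst (1 : R))).
  by apply: filterS PhiP => n Phin /=; rewrite (posdef1 Phin).
- move=> x; apply: ulim_near_cvg (cv x).
  by apply: filterS PhiP => n Phin /=; rewrite (posdef_even Phin).
- move=> s; have c : (fun n => quadform (Phi n) s) @ natU --> quadform (plim Phi) s.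
    apply: cvg_sum_seq => p; apply: cvg_sum_seq => q.
    by apply: cvgMr; exact: cv.
  apply: (cvgr_to_ge c).
  by apply: filterS PhiP => n Phin; exact: posdef_ge0.
Qed.

Definition dAlembert phi := forall x g, phi (x + g) + phi (x - g) = 2 * phi g * phi x.

Definition extreme_posdef phi := forall t psi1 psi2, 0 < t < 1 ->
  posdef psi1 -> posdef psi2 ->
  (forall x, phi x = t * psi1 x + (1 - t) * psi2 x) -> psi1 = phi.

(** Both functions d |-> 2 phi(d) +- (phi(d + g) + phi(d - g)) are positive
   semidefinite, with values 2 +- 2 phi(g) at 0, and phi is a quarter of their sum.
   By extremality the normalised one with sign + is phi, which is d'Alembert's
   equation.  If phi(g) = -1 or 1, one of the two vanishes at 0, hence
   everywhere, and the equation follows at once. *)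
Lemma extreme_dAlembert phi : posdef phi -> extreme_posdef phi -> dAlembert phi.
Proof.
move=> pd ext x g.
pose psi (e : R) d := 2 * phi d + e * (phi (d + g) + phi (d - g)).
have psi_even e d : psi e (- d) = psi e d.
  have E1 : - d + g = - (d - g) by rewrite opprB addrC.
  have E2 : - d - g = - (d + g) by rewrite opprD.
  by rewrite /psi E1 E2 !(posdef_even pd) [phi (d - g) + _]addrC.
have psi_psd e s : e ^+ 2 = 1 -> 0 <= quadform (psi e) s.
  by move=> e2; rewrite quadform_laplacian // (posdef_ge0 pd).
have psi0 e : psi e 0 = 2 + e * (2 * phi g).
  by rewrite /psi add0r sub0r (posdef_even pd) (posdef1 pd) mulr1; ring.
have e1 : (1 : R) ^+ 2 = 1 by rewrite expr1n.
have eN1 : (-1 : R) ^+ 2 = 1 by rewrite sqrrN expr1n.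
have le1 := posdef_norm_le g pd; rewrite ler_norml in le1.
have /andP[gm1 g1] := le1.
have zero e : e ^+ 2 = 1 -> psi e 0 = 0 -> psi e x = 0.
  move=> e2 e0; have := @psd_norm_le (psi e) x (psi_even e) (fun s => psi_psd e s e2).
  by rewrite e0 normr_le0 => /eqP.
have [gE|gN1] := eqVneq (phi g) (-1).
  have h : psi 1 x = 0 by apply: (zero 1 e1); rewrite psi0 gE; ring.
  by rewrite gE; move: h; rewrite /psi; lra.
have [gE|gN2] := eqVneq (phi g) 1.
  have h : psi (-1) x = 0 by apply: (zero (-1) eN1); rewrite psi0 gE; ring.
  by rewrite gE; move: h; rewrite /psi; lra.
have gm1' : -1 < phi g by rewrite lt_neqAle eq_sym gN1.
have g1' : phi g < 1 by rewrite lt_neqAle gN2.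
pose m e : R := 2 + e * (2 * phi g).
have m1 : 0 < m 1 by rewrite /m; lra.
have mN1 : 0 < m (-1) by rewrite /m; lra.
have pdpsi e : e ^+ 2 = 1 -> 0 < m e -> posdef (fun d => (m e)^-1 * psi e d).
  move=> e2 m0; split.
  - by rewrite psi0 mulVf // gt_eqF.
  - by move=> d; rewrite psi_even.
  - move=> s; rewrite quadform_scale; apply: mulr_ge0; last exact: psi_psd.
    by rewrite invr_ge0 ltW.
have t01 : 0 < m 1 / 4 < 1 by rewrite /m; apply/andP; split; lra.
have comb d : phi d = m 1 / 4 * ((m 1)^-1 * psi 1 d) +
    (1 - m 1 / 4) * ((m (-1))^-1 * psi (-1) d).
  have -> : (1 - m 1 / 4) = m (-1) / 4 by rewrite /m; field.
  have E e : 0 < m e -> m e / 4 * ((m e)^-1 * psi e d) = psi e d / 4.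
    by move=> m0; field; rewrite gt_eqF.
  by rewrite !E // /psi; field.
have /(congr1 (fun h => m 1 * h x)) := ext _ _ _ t01 (pdpsi _ e1 m1) (pdpsi _ eN1 mN1) comb.
rewrite mulrA mulfV ?gt_eqF // mul1r.
by rewrite /psi /m; lra.
Qed.

End PositiveDefinite.

(** * D'Alembert's equation and characters *)

Section Kannappan.
Context {R : realType} {G : zmodType}.
Implicit Types (phi : G -> R) (x y g : G).

(** Kannappan's theorem: phi is a cosine.  If phi only takes the values 1 and -1
   it is multiplicative and the sine is 0.  Otherwise pick a with phi(a)^2 < 1;
   from cos(x + a) - cos(x - a) = - 2 sin(x) sin(a) one reads off the sine, up to
   sign. *)
Lemma dAlembert_sine phi : phi 0 = 1 -> (forall x, `|phi x| <= 1) ->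
  dAlembert phi -> exists psi : G -> R,
    [/\ forall x y, phi (x + y) = phi x * phi y - psi x * psi y,
        forall x y, psi (x + y) = psi x * phi y + phi x * psi y &
        forall x, phi x ^+ 2 + psi x ^+ 2 = 1].
Proof.
move=> phi0 phi1 dA.
have even x : phi (- x) = phi x by have := dA 0 x; rewrite add0r sub0r phi0; lra.
have dbl x : phi (x + x) = 2 * phi x ^+ 2 - 1.
  by have := dA x x; rewrite subrr phi0 expr2; lra.
have [all1|] := pselect (forall x, phi x ^+ 2 = 1).
  exists (fun=> 0); split => [x y|x y|x]; rewrite ?mulr0 ?mul0r ?subr0 ?addr0 //.
    have := dA x y; have := all1 x; have := all1 y.
    have := phi1 (x + y); have := phi1 (x - y); rewrite !ler_norml.
    move=> /andP[? ?] /andP[? ?] /eqP; rewrite sqrf_eq1 => /orP[] /eqP ->;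
    move=> /eqP; rewrite sqrf_eq1 => /orP[] /eqP ->; lra.
  by rewrite expr0n /= addr0.
move=> /existsNP[a a1].
have a2 : 0 < 1 - phi a ^+ 2.
  have := phi1 a; rewrite ler_norml => /andP[? ?].
  rewrite subr_gt0 lt_neqAle; apply/andP; split; first exact/eqP.
  by nra.
pose c := Num.sqrt (1 - phi a ^+ 2).
have c0 : 0 < c by rewrite sqrtr_gt0.
have c2 : c ^+ 2 = 1 - phi a ^+ 2 by rewrite sqr_sqrtr // ltW.
pose psi x := (phi (x + a) - phi (x - a)) / (2 * c).
have psiM x y : psi x * psi y = (phi (x - y) - phi (x + y)) / 2.
  rewrite /psi mulf_div; apply/eqP; rewrite eqr_div; last 2 first.
  - by rewrite gt_eqF // !mulr_gt0.
  - by [].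
  apply/eqP.
  have -> : 2 * c * (2 * c) = 4 * c ^+ 2 by ring.
  have aa := dbl a; rewrite c2.
  have e1 := dA (x + a) (y + a); have e2 := dA (x + a) (y - a).
  have e3 := dA (x - a) (y + a); have e4 := dA (x - a) (y - a).
  have e5 := dA (x + y) (a + a); have e6 := dA (x - y) (a + a).
  have r1 : x + a + (y + a) = x + y + (a + a) by rewrite addrACA.
  have r2 : x + a - (y + a) = x - y by rewrite opprD addrACA subrr addr0.
  have r3 : x + a + (y - a) = x + y by rewrite addrACA subrr addr0.
  have r4 : x + a - (y - a) = x - y + (a + a) by rewrite opprB [a - y]addrC addrACA.
  have r5 : x - a + (y + a) = x + y by rewrite addrACA addNr addr0.
  have r6 : x - a - (y + a) = x - y - (a + a) by rewrite !opprD addrACA.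
  have r7 : x - a + (y - a) = x + y - (a + a) by rewrite opprD addrACA.
  have r8 : x - a - (y - a) = x - y by rewrite opprB addrA subrK.
  rewrite r1 r2 in e1; rewrite r3 r4 in e2; rewrite r5 r6 in e3; rewrite r7 r8 in e4.
  rewrite aa in e5 e6; nra.
exists psi.
have phiD x y : phi (x + y) = phi x * phi y - psi x * psi y.
  by rewrite psiM; have := dA x y; lra.
have psiN x : psi (- x) = - psi x.
  rewrite /psi -mulNr opprB; congr (_ / _).
  have -> : - x + a = - (x - a) by rewrite opprB addrC.
  have -> : - x - a = - (x + a) by rewrite opprD.
  by rewrite !even.
split => // [x y|x].
- rewrite /psi mulrAC [phi x * _]mulrA -mulrDl; congr (_ / _).
  have e1 := dA (x + a) y; have e2 := dA (x - a) y.
  have e3 := dA (y + a) x; have e4 := dA (y - a) x.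
  have r1 : x + a + y = x + y + a by rewrite addrAC.
  have r2 : x - a + y = x + y - a by rewrite addrAC.
  have r3 : y + a + x = x + y + a by rewrite addrAC [y + x]addrC.
  have r4 : y - a + x = x + y - a by rewrite addrAC [y + x]addrC.
  have r5 : y + a - x = - (x - a - y) by rewrite !opprB addrA.
  have r6 : y - a - x = - (x + a - y) by rewrite opprB [x + a]addrC opprD addrA.
  rewrite r1 in e1; rewrite r2 in e2; rewrite r3 r5 even in e3.
  by rewrite r4 r6 even in e4; lra.
- have := phiD x (- x); rewrite subrr phi0 even psiN; rewrite !expr2; lra.
Qed.

Local Open Scope complex_scope.

Lemma dAlembert_character phi : phi 0 = 1 -> (forall x, `|phi x| <= 1) ->
  dAlembert phi -> exists psi : G -> R,
    is_character (fun x => phi x +i* psi x) /\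
    forall x y, phi (x - y) = phi x * phi y + psi x * psi y.
Proof.
move=> phi0 phi1 dA; have [psi [phiD psiD norm1]] := dAlembert_sine phi0 phi1 dA.
exists psi; split; first split.
- by move=> x; rewrite normc_def /= norm1 sqrtr1.
- move=> x y; rewrite phiD psiD; apply/eqP; rewrite eq_complex /=.
  by apply/andP; split; apply/eqP; ring.
move=> x y; have := dA x y; rewrite phiD; lra.
Qed.

End Kannappan.

(** * Averages of positive definite functions along equidistributed sets *)

Section Energy.
Context {R : realType} {G : zmodType}.
Implicit Types (phi psi : G -> R) (s T : seq G) (t x y : G).

Definition laplacian t phi (d : G) : R := 2 * phi d + -1 * (phi (d + t) + phi (d - t)).

(** For phi(g) = <U_g v, v> this is the sum over t in T of the squared norm of
   p(U) (1 - U_t) v, where p(U) is the average of the U_x for x in s: it measures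
   how far the averaged vector is from being invariant. *)
Definition energy s T phi : R :=
  \sum_(t <- T) (size s)%:R^-2 * \sum_(x <- s) \sum_(y <- s) laplacian t phi (x - y).

Lemma energy_ge0 s T phi : posdef phi -> 0 <= energy s T phi.
Proof.
move=> pd; apply: sumr_ge0 => t _; apply: mulr_ge0; first by rewrite invr_ge0 exprn_ge0.
have := posdef_ge0 pd ([seq (1, x) | x <- s] ++ [seq (-1 * p.1, p.2 + t) | p <- [seq (1, x) | x <- s]]).
rewrite -quadform_laplacian ?sqrrN ?expr1n // /quadform big_map.
congr (0 <= _); apply: eq_bigr => x _; rewrite big_map; apply: eq_bigr => y _ /=.
by rewrite !mul1r.
Qed.

Lemma energy_le s T phi : posdef phi -> energy s T phi <= 4 * (size T)%:R.
Proof.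
move=> pd; rewrite /energy.
have lap4 t d : laplacian t phi d <= 4.
  have := posdef_norm_le d pd; have := posdef_norm_le (d + t) pd.
  have := posdef_norm_le (d - t) pd; rewrite !ler_norml /laplacian.
  by move=> /andP[? ?] /andP[? ?] /andP[? ?]; lra.
have -> : 4 * (size T)%:R = \sum_(t <- T) (4 : R).
  by rewrite big_const_seq count_predT iter_addr_0 mulr_natr.
apply: ler_sum => t _.
have [s0|sn0] := eqVneq (size s) 0%N.
  by rewrite s0 expr0n invr0 mul0r.
have sp : 0 < (size s)%:R ^+ 2 :> R by rewrite exprn_gt0 // ltr0n lt0n.
rewrite mulrC ler_pdivrMr //.
have -> : 4 * (size s)%:R ^+ 2 = \sum_(x <- s) \sum_(y <- s) (4 : R).
  rewrite !big_const_seq !count_predT !iter_addr_0 -mulrnA.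
  by rewrite -[RHS]mulr_natr natrM expr2.
by apply: ler_sum => x _; apply: ler_sum => y _; exact: lap4.
Qed.

(** The functionals to which Simons's inequality is applied; they attain their
   maximum over posdef at solutions of d'Alembert's equation. *)
Definition affine_continuous (u : (G -> R) -> R) :=
  ucontinuous posdef u /\
  forall (c : R) phi (psi1 psi2 : G -> R), 0 < c < 1 ->
    posdef phi -> posdef psi1 -> posdef psi2 ->
    (forall x, phi x = c * psi1 x + (1 - c) * psi2 x) ->
    u phi = c * u psi1 + (1 - c) * u psi2.

Lemma affine_continuous_comb a b u v : affine_continuous u -> affine_continuous v ->
  affine_continuous (fun phi => a * u phi + b * v phi).
Proof.
move=> [uc ua] [vc va]; split; first exact: ucontinuous_comb.
move=> c phi psi1 psi2 c01 pd pd1 pd2 E.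
by rewrite (ua _ _ _ _ c01 pd pd1 pd2 E) (va _ _ _ _ c01 pd pd1 pd2 E); ring.
Qed.

Lemma affine_continuous_coord x : affine_continuous (fun phi => phi x).
Proof.
split; last by move=> c phi psi1 psi2 _ _ _ _ ->.
by apply: (@ucontinuous_coord _ _ _ _ 1) => phi; exact: posdef_norm_le.
Qed.

Lemma affine_continuous_scale a u : affine_continuous u ->
  affine_continuous (fun phi => a * u phi).
Proof.
move=> uc; have := affine_continuous_comb a 0 uc uc.
by congr affine_continuous; apply: funext => phi; rewrite mul0r addr0.
Qed.

Lemma affine_continuousD u v : affine_continuous u -> affine_continuous v ->
  affine_continuous (fun phi => u phi + v phi).
Proof.
move=> uc vc; have := affine_continuous_comb 1 1 uc vc.
by congr affine_continuous; apply: funext => phi; rewrite !mul1r.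
Qed.

Lemma affine_continuous_sum (I : Type) (r : seq I) (F : I -> (G -> R) -> R) :
  (forall i, affine_continuous (F i)) ->
  affine_continuous (fun phi => \sum_(i <- r) F i phi).
Proof.
move=> FV; elim: r => [|i r IH].
  have := affine_continuous_scale 0 (affine_continuous_coord 0).
  by congr affine_continuous; apply: funext => phi; rewrite big_nil mul0r.
have := affine_continuousD (FV i) IH.
by congr affine_continuous; apply: funext => phi; rewrite big_cons.
Qed.

Lemma affine_continuous_energy s T : affine_continuous (energy s T).
Proof.
apply: affine_continuous_sum => t; apply: affine_continuous_scale.
apply: affine_continuous_sum => x; apply: affine_continuous_sum => y.
apply: affine_continuousD; first exact/affine_continuous_scale/affine_continuous_coord.
apply: affine_continuous_scale.
by apply: affine_continuousD; exact: affine_continuous_coord.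
Qed.

Lemma affine_continuous_unif (M : R) (u : nat -> (G -> R) -> R) v :
  (forall n, affine_continuous (u n)) ->
  (forall n phi, posdef phi -> `|v phi - u n phi| <= 2^-1 ^+ n * M) ->
  affine_continuous v.
Proof.
move=> uV uv; have rM : (fun n => 2^-1 ^+ n * M) @ \oo --> 0.
  rewrite -(mul0r M); apply: cvgMl; apply: cvg_expr.
  by rewrite ger0_norm // invf_lt1 // ltr1n.
have small e : 0 < e -> exists n, 2^-1 ^+ n * M < e.
  move=> e0; have : \forall n \near \oo, 2^-1 ^+ n * M < e by exact: (cvgr_lt _ rM).
  by move=> /filter_ex[n]; exists n.
split; last first.
  move=> c phi psi1 psi2 c01 pd pd1 pd2 E; apply/eqP; rewrite -subr_eq0.
  apply/negPn/negP => ne0; set D := _ - _ in ne0.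
  have [|n nD] := small (`|D| / 3); first by rewrite divr_gt0 // normr_gt0.
  have h := uv n _ pd; have h1 := uv n _ pd1; have h2 := uv n _ pd2.
  have D0 : 0 < `|D| by rewrite normr_gt0.
  suff : `|D| <= 2 * (2^-1 ^+ n * M) by lra.
  have /andP[c0 c1] := c01.
  have -> : D = (v phi - u n phi) - (c * (v psi1 - u n psi1) +
      (1 - c) * (v psi2 - u n psi2)).
    by rewrite /D ((uV n).2 _ _ _ _ c01 pd pd1 pd2 E); ring.
  rewrite ler_norml in h; rewrite ler_norml in h1; rewrite ler_norml in h2.
  move: h h1 h2 => /andP[? ?] /andP[? ?] /andP[? ?].
  by rewrite ler_norml; apply/andP; split; nra.
split.
  have [[c uc] _] := (uV 0%N).1; exists (c + M) => phi pd.
  have := uv 0%N phi pd; rewrite expr0 mul1r => h.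
  by rewrite -[v phi](subrK (u 0%N phi)) addrC (le_trans (ler_normD _ _)) // lerD // uc.
move=> Phi PhiP; have pdl : posdef (plim Phi) by exact: posdef_uclosed.
apply/cvgrPdist_le => e e0.
have [n ne] := small (e / 3) (divr_gt0 e0 (ltr0n _ 3)).
have [_ /(_ Phi PhiP)/cvgrPdist_le/(_ (e / 3) (divr_gt0 e0 (ltr0n _ 3)))] := (uV n).1.
apply: filterS2 PhiP => k pdk h.
have h1 := uv n _ pdl; have h2 := uv n _ pdk.
rewrite !ler_norml in h h1 h2 *.
by move: h h1 h2 => /andP[? ?] /andP[? ?] /andP[? ?]; apply/andP; split; lra.
Qed.

Lemma extreme_maximiser u : countable [set: G] -> (@posdef R G) !=set0 ->
  affine_continuous u -> exists phi, [/\ posdef phi /\ dAlembert phi, posdef phi &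
    forall psi, posdef psi -> u psi <= u phi].
Proof.
move=> hG pd0 [uc ua]; have [e esurj] := countable_enumeration hG.
pose h j := if j is j'.+1 then fun phi : G -> R => phi (e j') else u.
have hc j : ucontinuous (@posdef R G) (h j).
  by case: j => [|j] //; exact: (affine_continuous_coord (e j)).1.
have [phi [pd phimax phiext]] := lex_maximiser pd0 (@posdef_uclosed R G) hc.
exists phi; split => //; split => //; apply: extreme_dAlembert => //.
move=> c psi1 psi2 c01 pd1 pd2 E; apply: funext => x; have [j <-] := esurj x.
apply: (phiext c psi1 psi2 c01 pd1 pd2 _ j.+1) => -[|i] /=; last exact: E.
exact: ua.
Qed.

Lemma energy_dAlembert s T phi psi : dAlembert phi ->
  (forall x y, phi (x - y) = phi x * phi y + psi x * psi y) ->
  energy s T phi = \sum_(t <- T) 2 * (1 - phi t) *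
    (((size s)%:R^-1 * \sum_(x <- s) phi x) ^+ 2 +
     ((size s)%:R^-1 * \sum_(x <- s) psi x) ^+ 2).
Proof.
move=> dA phiB; apply: eq_bigr => t _.
have -> : \sum_(x <- s) \sum_(y <- s) laplacian t phi (x - y) =
  2 * (1 - phi t) * ((\sum_(x <- s) phi x) ^+ 2 + (\sum_(x <- s) psi x) ^+ 2).
  rewrite !expr2 !mulr_suml -big_split mulr_sumr /=; apply: eq_bigr => x _.
  rewrite !mulr_sumr -big_split mulr_sumr /=; apply: eq_bigr => y _.
  by rewrite /laplacian dA -phiB; ring.
by rewrite !exprMn exprVn; ring.
Qed.

Local Open Scope complex_scope.

Lemma character_average (phi psi : G -> R) s :
  ((size s)%:R^-1 * \sum_(g <- s) (phi g +i* psi g) : R[i]) =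
  ((size s)%:R^-1 * \sum_(g <- s) phi g) +i* ((size s)%:R^-1 * \sum_(g <- s) psi g).
Proof.
have -> : \sum_(g <- s) (phi g +i* psi g) =
    (\sum_(g <- s) phi g) +i* (\sum_(g <- s) psi g).
  elim: s => [|g s IH]; first by rewrite !big_nil.
  by rewrite !big_cons IH.
rewrite -(rmorph_nat (real_complex R)) -fmorphV.
by apply/eqP; rewrite eq_complex /=; apply/andP; split; apply/eqP; ring.
Qed.

(** At phi = Re chi the energy is a constant, zero if chi is trivial, times the
   squared modulus of the average of chi over s n. *)
Lemma energy_cvg0 (s : nat -> seq G) T phi : posdef phi -> dAlembert phi ->
  (forall chi : G -> R[i], is_character chi -> (exists g, chi g != 1) ->
    (fun n => (size (s n))%:R^-1 * \sum_(g <- s n) chi g : R[i]^o) @ \oo -->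
      (0 : R[i]^o)) ->
  (fun n => energy (s n) T phi) @ \oo --> 0.
Proof.
move=> pd dA sequi.
have [psi [chi_char phiB]] := dAlembert_character (posdef1 pd) (fun x => posdef_norm_le x pd) dA.
have [triv|nontriv] := pselect (forall t, phi t = 1).
  have -> : (fun n => energy (s n) T phi) = (fun=> 0).
    apply: funext => n; rewrite (energy_dAlembert _ _ dA phiB) big1 // => t _.
    by rewrite triv subrr mulr0 mul0r.
  exact: cvg_cst.
have /(sequi _ chi_char) c : exists g, phi g +i* psi g != 1.
  move/existsNP: nontriv => [g /eqP g1]; exists g; rewrite eq_complex /=.
  by rewrite negb_and g1.
have small e : 0 < e -> \forall n \near \oo,
    Num.sqrt (((size (s n))%:R^-1 * \sum_(g <- s n) phi g) ^+ 2 +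
      ((size (s n))%:R^-1 * \sum_(g <- s n) psi g) ^+ 2) <= e.
  move=> e0; have eC0 : 0 < e%:C by rewrite ltcR.
  have /cvgr0Pnorm_le/(_ _ eC0) := c.
  by apply: filterS => n; rewrite character_average normc_def /= lecR.
have cRe : (fun n => (size (s n))%:R^-1 * \sum_(g <- s n) phi g) @ \oo --> 0.
  apply/cvgr0Pnorm_le => e /small; apply: filterS => n; apply: le_trans.
  by rewrite -sqrtr_sqr ler_wsqrtr // lerDl sqr_ge0.
have cIm : (fun n => (size (s n))%:R^-1 * \sum_(g <- s n) psi g) @ \oo --> 0.
  apply/cvgr0Pnorm_le => e /small; apply: filterS => n; apply: le_trans.
  by rewrite -sqrtr_sqr ler_wsqrtr // lerDr sqr_ge0.
have -> : (fun n => energy (s n) T phi) =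
    (fun n => (\sum_(t <- T) 2 * (1 - phi t)) *
    (((size (s n))%:R^-1 * \sum_(x <- s n) phi x) ^+ 2 +
     ((size (s n))%:R^-1 * \sum_(x <- s n) psi x) ^+ 2)).
  by apply: funext => n; rewrite (energy_dAlembert _ _ dA phiB) mulr_suml.
rewrite -[X in _ --> X](mulr0 (\sum_(t <- T) 2 * (1 - phi t))).
apply: cvgMr; rewrite -[X in _ --> X]addr0 -[X in X + X](mulr0 (0 : R)).
by apply: cvgD; apply: cvgM.
Qed.

(** Equidistribution gives pointwise convergence of the energies to 0 at the extreme
   phi only; Simons's inequality extends it to all phi, as dominated convergence
   for the spectral measure of phi would. *)
Theorem exists_small_energy (s : nat -> seq G) T phi (eps : R) :
  countable [set: G] -> posdef phi -> 0 < eps ->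
  (forall chi : G -> R[i], is_character chi -> (exists g, chi g != 1) ->
    (fun n => (size (s n))%:R^-1 * \sum_(g <- s n) chi g : R[i]^o) @ \oo -->
      (0 : R[i]^o)) ->
  exists n, energy (s n) T phi < eps.
Proof.
move=> hG pd eps0 sequi; apply: contrapT => /forallNP large.
apply: (@simons_absurd R (G -> R) (@posdef R G)
  [set phi | posdef phi /\ dAlembert phi] affine_continuous
  (fun n => energy (s n) T) (4 * (size T)%:R) _ _ _ _ _ _ _ phi eps) => //.
- by move=> n; exact: affine_continuous_energy.
- by move=> a b u v; exact: affine_continuous_comb.
- exact: affine_continuous_unif.
- by move=> u uV; apply: extreme_maximiser => //; exists phi.
- by move=> n psi; exact: energy_ge0.
- by move=> n psi; exact: energy_le.
- by move=> psi [pdp dA]; exact: energy_cvg0.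
- by move=> n; rewrite leNgt; apply/negP; exact: large.
Qed.

End Energy.

(** * Gram matrices of sets *)

Section Gram.
Context {R : realType} {d : measure_display} {X : measurableType d}.
Context (mu : probability X R) {I : Type} (E : I -> set X).
Hypothesis mE : forall i, measurable (E i).
Implicit Types (D F : set X) (s : seq (R * I)).

Definition gram D s : R :=
  \sum_(p <- s) \sum_(q <- s) p.1 * q.1 * rmu mu (D `&` (E p.2 `&` E q.2)).

Definition gram_linear D s : R := \sum_(p <- s) p.1 * rmu mu (D `&` E p.2).

Lemma rmu_split D F F' : measurable D -> measurable F -> measurable F' ->
  rmu mu (D `&` F') = rmu mu ((D `&` F) `&` F') + rmu mu ((D `\` F) `&` F').
Proof.
move=> mD mF mF'; rewrite (rmuDI mu (measurableI _ _ mD mF') mF) addrC.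
congr (_ + _); congr fine; congr (mu _);
  by apply/seteqP; split=> x /=; rewrite /setI /setD /=; tauto.
Qed.

Lemma gram_split D F s : measurable D -> measurable F ->
  gram D s = gram (D `&` F) s + gram (D `\` F) s.
Proof.
move=> mD mF; rewrite -big_split; apply: eq_bigr => p _.
rewrite -big_split; apply: eq_bigr => q _ /=.
by rewrite (rmu_split mD mF) ?mulrDr //; exact: measurableI.
Qed.

Lemma gram_linear_split D F s : measurable D -> measurable F ->
  gram_linear D s = gram_linear (D `&` F) s + gram_linear (D `\` F) s.
Proof.
move=> mD mF; rewrite -big_split; apply: eq_bigr => p _ /=.
by rewrite (rmu_split mD mF) ?mulrDr.
Qed.

(** The right-hand side of the inequality is the integral over D of the square of
   c plus the sum of the a 1_(E i) for (a, i) in s.  Splitting D along the first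
   E i turns that term into a change of the constant c, which gives an induction
   without integrals. *)
Lemma gram_translate_ge0 s c D : measurable D ->
  0 <= gram D s + 2 * c * gram_linear D s + c ^+ 2 * rmu mu D.
Proof.
elim: s c D => [|p s IH] c D mD.
  by rewrite /gram /gram_linear !big_nil mulr0 !add0r mulr_ge0 ?sqr_ge0 ?rmu_ge0.
have mD1 : measurable (D `&` E p.2) by exact: measurableI.
have mD2 : measurable (D `\` E p.2) by exact: measurableD.
have := addr_ge0 (IH (c + p.1) _ mD1) (IH c _ mD2); congr (0 <= _).
have -> : gram D (p :: s) = p.1 ^+ 2 * rmu mu (D `&` E p.2) +
    2 * p.1 * gram_linear (D `&` E p.2) s + gram D s.
  rewrite /gram big_cons big_cons setIid.
  under [X in _ + X]eq_bigr do rewrite big_cons.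
  rewrite big_split /= expr2 -!addrA; congr (_ + _).
  rewrite addrA; congr (_ + _); rewrite -mulrA mulr2n mulrDl mul1r.
  by congr (_ + _); rewrite /gram_linear mulr_sumr; apply: eq_bigr => q _;
    rewrite ?setIA -?mulrA // [q.1 * (p.1 * _)]mulrCA -setIA (setIC (E q.2)) setIA.
have -> : gram_linear D (p :: s) = p.1 * rmu mu (D `&` E p.2) + gram_linear D s.
  by rewrite /gram_linear big_cons.
rewrite (gram_split s mD (mE p.2)) (gram_linear_split s mD (mE p.2)).
by rewrite (rmuDI mu mD (mE p.2)); ring.
Qed.

Lemma gram_ge0 s D : measurable D -> 0 <= gram D s.
Proof.
by move=> mD; have := gram_translate_ge0 s 0 mD; rewrite mulr0 mul0r expr0n /= mul0r !addr0.
Qed.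

(** Cauchy-Schwarz for the indicator of D and the function with square integral
   gram setT s: take minus the scalar product for the constant of the previous
   lemma, and use mu(D) <= 1. *)
Lemma gram_linear_sq_le s D : measurable D ->
  gram_linear D s ^+ 2 <= gram setT s.
Proof.
move=> mD; rewrite (gram_split s measurableT mD) setTI.
have := gram_ge0 s (measurableD measurableT mD).
have := gram_translate_ge0 s (- gram_linear D s) mD.
have := rmu_le1 mu mD; have := rmu_ge0 mu D; have := sqr_ge0 (gram_linear D s).
rewrite sqrrN; move: (gram_linear D s) (rmu mu D) => w r; nra.
Qed.

End Gram.

(** * Equidistributed sets are ergodic sets *)

Section EquidistributedErgodic.
Context {R : realType} {G : zmodType} (hG : countable [set: G]).
Context {d : measure_display} {X : measurableType d} (mu : probability X R).
Context (act : G -> X -> X) (Gact : is_Gspace mu act).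
Implicit Types (B C : set X) (x y t g : G) (s T : seq G).

Lemma image_actD a g B : act (a + g) @` B = act a @` (act g @` B).
Proof.
by rewrite !(image_actE Gact); apply/seteqP; split => x;
  rewrite /= -(Gspace_actD Gact) opprD [- g - a]addrC.
Qed.

Lemma image_actI a B C : act a @` (B `&` C) = (act a @` B) `&` (act a @` C).
Proof. by rewrite !(image_actE Gact) preimage_setI. Qed.

Lemma rmu_actB x y B : measurable B ->
  rmu mu (act (x - y) @` B `&` B) = rmu mu (act x @` B `&` act y @` B).
Proof.
move=> mB; have mxB : measurable (act (x - y) @` B) by exact: (measurable_act Gact).
rewrite -(rmu_act Gact y (measurableI _ _ mxB mB)) image_actI.
by rewrite -image_actD addrC subrK.
Qed.

Definition correlation B g : R := (rmu mu B)^-1 * rmu mu (act g @` B `&` B).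

Lemma quadform_correlation B (c : seq (R * G)) : measurable B ->
  quadform (correlation B) c = (rmu mu B)^-1 * gram mu (fun g => act g @` B) setT c.
Proof.
move=> mB; rewrite /correlation quadform_scale; congr (_ * _).
apply: eq_bigr => p _; apply: eq_bigr => q _.
by rewrite setTI rmu_actB.
Qed.

Lemma posdef_correlation B : measurable B -> 0 < rmu mu B -> posdef (correlation B).
Proof.
move=> mB B0; have mact g : measurable (act g @` B) by exact: (measurable_act Gact).
split.
- rewrite /correlation (_ : act 0 @` B = B) ?setIid ?mulVf ?gt_eqF //.
  by rewrite (image_actE Gact) oppr0; apply/seteqP; split => x; rewrite /= (Gspace_act0 Gact).
- move=> g; congr (_ * _); rewrite -(sub0r g) rmu_actB // setIC.
  by rewrite -rmu_actB // subr0.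
- move=> s; rewrite quadform_correlation //.
  by rewrite mulr_ge0 ?invr_ge0 ?(ltW B0) //; exact: gram_ge0.
Qed.

(** Let u be the sum over x in s of 1_(xB) - 1_((x - t)B).  Its scalar product with
   1_C only sees the translates by x - t, and the square of its norm is the double
   sum on the right. *)
Lemma sum_return_sq_le B C t s : measurable B -> measurable C -> 0 < rmu mu B ->
  (forall x, x \in s -> act x @` B `&` C = set0) ->
  (\sum_(x <- s) rmu mu (act x @` B `&` act t @` C)) ^+ 2 <=
  rmu mu B * \sum_(x <- s) \sum_(y <- s) laplacian t (correlation B) (x - y).
Proof.
move=> mB mC B0 disj; have mact g : measurable (act g @` B) by exact: (measurable_act Gact).
pose c := [seq (1 : R, x) | x <- s].
pose c' := c ++ [seq (-1 * p.1, p.2 + (- t)) | p <- c].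
have -> : \sum_(x <- s) \sum_(y <- s) laplacian t (correlation B) (x - y) =
    quadform (correlation B) c'.
  rewrite -quadform_laplacian ?sqrrN ?expr1n // /quadform big_map.
  apply: eq_bigr => x _; rewrite big_map; apply: eq_bigr => y _ /=.
  by rewrite /laplacian !mul1r opprK; congr (_ + _ * _); rewrite addrC.
rewrite quadform_correlation // mulrA mulfV ?gt_eqF // mul1r.
apply: le_trans (gram_linear_sq_le mu mact c' mC).
rewrite le_eqVlt; apply/orP; left; apply/eqP; rewrite -sqrrN; congr (_ ^+ 2).
have z : \sum_(x <- s) 1 * rmu mu (C `&` act x @` B) = 0.
  by rewrite big_seq big1 // => x /disj xC; rewrite setIC xC rmu0 mulr0.
rewrite /gram_linear big_cat /= !big_map /= z add0r.
rewrite -sumrN; apply: eq_bigr => x _ /=; rewrite mulr1 mulN1r; congr (- _).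
have mxt : measurable (act (x - t) @` B) by exact: mact.
rewrite (setIC C) -(rmu_act Gact t (measurableI _ _ mxt mC)) image_actI.
by rewrite -image_actD [t + _]addrC subrK.
Qed.

Lemma rmu_cover_le C T D : measurable C -> measurable D ->
  rmu mu (D `&` actset act [set` T] C) <= \sum_(t <- T) rmu mu (D `&` act t @` C).
Proof.
move=> mC mD; elim: T => [|t T IH].
  by rewrite big_nil /actset set_nil bigcup_set0 setI0 rmu0.
rewrite big_cons actset_cons setIUr.
have mt : measurable (act t @` C) by exact: (measurable_act Gact).
have mT : measurable (actset act [set` T] C) by exact: (measurable_actset hG Gact).
apply: le_trans (le_rmuU _ _ _) _; [exact: measurableI|exact: measurableI|].
by rewrite lerD2l.
Qed.

(** Suppose that C, the complement of SB, is not null.  By ergodicity finitely many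
   translates tC, t in T, cover all but a small part of X, so each xB meets them
   in measure at least mu(B) / 2 in total.  For x in S, however, xB misses C, and
   by Cauchy-Schwarz the average over x in F n of mu(xB n tC) is controlled by
   the energy of the correlations of B, which is small for a suitable n. *)
Theorem equidistributed_ergodic_set (S : set G) :
  equidistributed R S -> ergodic mu act -> ergodic_set mu act S.
Proof.
move=> [F [F0 _ FS] Fequi] erg B mB; rewrite (@rmuE _ _ _ mu) // lte_fin => B0.
rewrite -/(actset act S B); set D := actset act S B.
have mD : measurable D by exact: (measurable_actset hG Gact).
have [D1|D1] := eqVneq (rmu mu D) 1; first by rewrite (@rmuE _ _ _ mu) // D1.
exfalso; pose C := ~` D; have mC : measurable C by exact: measurableC.
have C0 : 0 < rmu mu C.
  by rewrite /C -setTD rmuD_sub // rmu_setT subr_gt0 lt_neqAle D1 rmu_le1.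
pose U := actset act setT C.
have mU : measurable U by exact: (measurable_actset hG Gact).
have CU : C `<=` U.
  by move=> x Cx; exists 0 => //; exists x => //; rewrite (Gspace_act0 Gact).
have Uinv g : act g @` U = U.
  apply/seteqP; split => [_ [_ [a _ [x Cx <-]] <-]|_ [a _ [x Cx <-]]].
    by exists (g + a) => //; exists x => //; rewrite (Gspace_actD Gact).
  exists (act (a - g) x); first by exists (a - g) => //; exists x.
  by rewrite -(Gspace_actD Gact) addrC subrK.
have U1 : rmu mu U = 1.
  apply/eqP/negPn/negP => U1; apply: erg; exists U; split => //.
  rewrite (@rmuE _ _ _ mu) // !lte_fin (lt_le_trans C0 (le_rmu _ _ _ _)) //=.
  by rewrite lt_neqAle U1 rmu_le1.
pose b := rmu mu B.
have [T TC] : exists T : seq G, 1 - b / 2 < rmu mu (actset act [set` T] C).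
  have [s [_ cs]] := actset_exhaustion hG Gact setT.
  have : \forall n \near \oo, 1 - b / 2 < rmu mu (actset act [set` s n] C).
    apply: (cvgr_gt _ (cs C mC)); rewrite -/U U1; have : 0 < b by []; lra.
  by move=> /filter_ex[n]; exists (s n).
have mTC : measurable (actset act [set` T] C) by exact: (measurable_actset hG Gact).
have pd := posdef_correlation mB B0.
pose k : R := (size T)%:R; have k0 : 0 <= k by exact: ler0n.
have eps0 : 0 < b / (4 * (k + 1)) by rewrite divr_gt0 // mulr_gt0 // ltr_wpDl.
have [n] := exists_small_energy (s := fun n => enum_fset (F n)) T hG pd eps0 Fequi.
set s : seq G := enum_fset (F n).
have sS x : x \in s -> S x by move=> xs; rewrite -FS; exists n.
have N0 : 0 < (size s)%:R :> R.
  by rewrite ltr0n -/(#|` F n|) lt0n cardfs_eq0 F0.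
pose N : R := (size s)%:R.
pose W t := \sum_(x <- s) rmu mu (act x @` B `&` act t @` C).
have mact a Z : measurable Z -> measurable (act a @` Z) by exact: (measurable_act Gact).
have sumW : N * (b / 2) <= \sum_(t <- T) W t.
  rewrite exchange_big /=.
  have -> : N * (b / 2) = \sum_(x <- s) (b / 2).
    by rewrite big_const_seq count_predT iter_addr_0 -[RHS]mulr_natl.
  apply: ler_sum => x _; apply: le_trans (rmu_cover_le T mC (mact x _ mB)).
  have := rmuDI mu (mact x _ mB) mTC; rewrite (rmu_act Gact x mB) -/b.
  have : rmu mu (act x @` B `\` actset act [set` T] C) <=
      rmu mu (~` actset act [set` T] C).
    apply: le_rmu; [by apply: measurableD => //; exact: mact|exact: measurableC|].
    by move=> y [].
  have : rmu mu (~` actset act [set` T] C) < b / 2.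
    by rewrite -setTD rmuD_sub // rmu_setT; lra.
  lra.
have W2 t : (N^-1 * W t) ^+ 2 <=
    b * (N^-2 * \sum_(x <- s) \sum_(y <- s) laplacian t (correlation B) (x - y)).
  rewrite exprMn exprVn [leRHS]mulrCA ler_wpM2l ?invr_ge0 ?exprn_ge0 ?(ltW N0) //.
  apply: sum_return_sq_le => // x /sS Sx; apply/seteqP; split => // y [Bxy]; apply.
  by exists x.
have sumW2 : \sum_(t <- T) (N^-1 * W t) ^+ 2 <= b * energy s T (correlation B).
  by rewrite /energy mulr_sumr; apply: ler_sum => t _; exact: W2.
(* Summing 2 dl w - dl^2 <= w^2 over T, where w = W t / N; this dl makes the lower
   bound exceed b * (b / (4 (k + 1))). *)
pose dl := b / (2 * (k + 1)).
have : 2 * dl * (b / 2) - k * dl ^+ 2 <= \sum_(t <- T) (N^-1 * W t) ^+ 2.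
  apply: (@le_trans _ _ (\sum_(t <- T) (2 * dl * (N^-1 * W t) - dl ^+ 2))).
    rewrite sumrB -mulr_sumr -mulr_sumr big_const_seq count_predT iter_addr_0.
    rewrite -[X in _ <= _ - X]mulr_natl lerD2r ler_wpM2l //.
      by rewrite mulr_ge0 // divr_ge0 // ?(ltW B0) // mulr_ge0 // addr_ge0.
    by rewrite [leRHS]mulrC ler_pdivlMr // [leLHS]mulrC.
  apply: ler_sum => t _; have := sqr_ge0 (N^-1 * W t - dl).
  by rewrite sqrrB; lra.
have key : b * (b / (4 * (k + 1))) <= 2 * dl * (b / 2) - k * dl ^+ 2.
  have k1 : 0 < k + 1 by rewrite ltr_wpDl.
  have -> : 2 * dl * (b / 2) - k * dl ^+ 2 =
      b * (b / (4 * (k + 1))) + b * (b / (4 * (k + 1) ^+ 2)).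
    by rewrite /dl; field; rewrite gt_eqF.
  by rewrite lerDl mulr_ge0 ?(ltW B0) // divr_ge0 ?(ltW B0) // mulr_ge0 // sqr_ge0.
move=> le2 small; have := le_trans key (le_trans le2 sumW2).
by rewrite ler_pM2l // leNgt small.
Qed.

End EquidistributedErgodic.

Theorem corollary1p1 (R : realType) (G : zmodType)
    (hG : countable [set: G]) (k : nat) (hk : (1 <= k)%N) (A : set G) :
  (ergodic_basis R k A -> forall B : set G,
     upper_density R (sumset A B) >=
       powRz (upper_density R B) (1 - k%:R^-1) /\
     lower_density R (sumset A B) >=
       powRz (lower_density R B) (1 - k%:R^-1)) /\
  (equidistributed R (nsumset A k) -> forall B : set G,
     upper_density R (sumset A B) >=
       powRz (upper_density R B) (1 - k%:R^-1) /\
     lower_density R (sumset A B) >=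
       powRz (lower_density R B) (1 - k%:R^-1)).
Proof.
split=> [Abasis B|Aequi B]; first exact: ergodic_basis_density.
apply: ergodic_basis_density => // d X mu act Gact erg.
exact: equidistributed_ergodic_set.
Qed.
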